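(* Let $H=(V,E)$ be a partition-connected hypergraph with $|V|\ge 2$ and let $\Gamma(H)$ be its family of hypertrees. Assume that the optimal density $\eta^*$ of $\operatorname{Mod}_2(\widehat\Gamma(H))$ is not a constant vector, and let $E_{max}$ be the set of hyperedges $e$ at which $\eta^*(e)$ attains the maximum value of $\eta^*$. Let $H/(E-E_{max})$ be the hypergraph obtained from $H$ by contracting $E-E_{max}$. Let $L_1,\dots,L_k$, with $L_i=(V_i,C_i)$, be the connected components of the hypergraph $H[E-E_{max}]$. Then: (i) The hypergraph $H/(E-E_{max})$ and every hypergraph $L_i$, $i=1,\dots,k$, are partition-connected. (ii) $$\operatorname{Mod}_2(\widehat\Gamma(H))=\operatorname{Mod}_2(\widehat\Gamma(L_1))+\dots+\operatorname{Mod}_2(\widehat\Gamma(L_k))+\operatorname{Mod}_2(\widehat\Gamma(H/(E-E_{max}))).$$ (iii) The restriction of $\eta^*$ to $C_i$ is optimal for $\operatorname{Mod}_2(\widehat\Gamma(L_i))$ for $i=1,\dots,k$, and the restriction of $\eta^*$ to $E_{max}$ is optimal for $\operatorname{Mod}_2(\widehat\Gamma(H/(E-E_{max})))$.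
   Context: A hypergraph $H=(V,E)$ has a finite nonempty vertex set $V$ and a finite collection $E$ of subsets of $V$ (hyperedges), where repetitions are allowed (parallel hyperedges are distinct elements of $E$) and every hyperedge has at least two vertices. A hypergraph is connected if for every nonempty proper subset $X$ of its vertex set some hyperedge intersects both $X$ and its complement. For $F\subseteq E$, $H[F]$ is the hypergraph with vertex set $\bigcup_{e\in F}e$ and hyperedge set $F$. For a partition $\mathscr P$ of $V$ into nonempty parts, $|\mathscr P|$ is the number of parts and $\delta(\mathscr P)$ is the set of hyperedges intersecting at least two parts. $H$ is partition-connected if $|\delta(\mathscr P)|\ge|\mathscr P|-1$ for every partition $\mathscr P$ of $V$. For a hyperedge $f$, $H/f$ is obtained by merging the vertices of $f$ into one new vertex (in every hyperedge $e\ne f$ meeting $f$, replace $e\cap f$ by the new vertex) and removing resulting loops; $H/F$ is obtained by contracting all hyperedges of $F$. Hyperedges of $H/F$ are identified with the hyperedges of $H$ they come from (in particular the hyperedges of $H/(E-E_{max})$ are identified with elements of $E_{max}$). A set $F\subseteq E$ is a hyperforest if for every nonempty $X\subseteq V$ at most $|X|-1$ hyperedges of $F$ are contained in $X$; a hypertree is a hyperforest with $|F|=|V|-1$. $\Gamma(H)$ is the family of all hypertrees of $H$, each identified with its indicator vector in $\mathbb{R}^E_{\ge 0}$. For a family $\Gamma\subset\mathbb{R}^E_{\ge0}$, $\operatorname{Adm}(\Gamma)=\{\rho\in\mathbb{R}^E_{\ge0}:\gamma^T\rho\ge1\ \forall\gamma\in\Gamma\}$; the Fulkerson blocker family $\widehat\Gamma$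 is the set of extreme points of $\operatorname{Adm}(\Gamma)$; $\operatorname{Mod}_2(\Gamma)=\inf_{\rho\in\operatorname{Adm}(\Gamma)}\sum_{e\in E}\rho(e)^2$, and its optimal density is the unique minimizer. *)

(* Defs.v *)
From mathcomp Require Import all_boot all_order all_algebra.
From mathcomp Require Import all_classical all_reals ereal.
From mathcomp Require Import finset.
Set Implicit Arguments.
Unset Strict Implicit.
Unset Printing Implicit Defensive.
Import Order.TTheory GRing.Theory Num.Theory.
Local Open Scope ring_scope.

(* Vertices and hyperedges are drawn from ambient finite types, so that the
   hypergraphs derived from H share its hyperedge names.  Parallel hyperedges
   are distinct e, f : E with ends e = ends f; the values of ends outside
   edges are irrelevant.  The vertex set may be empty, because H[F] has no
   vertices when F is empty. *)
Record hypergraph (V E : finType) := Hypergraph {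
  verts : {set V};
  edges : {set E};
  ends : E -> {set V};
  ends_sub : forall e, e \in edges -> ends e \subset verts;
  ends_card : forall e, e \in edges -> (2 <= #|ends e|)%N
}.

Section Hypergraphs.
Variables V E : finType.
Implicit Types (H : hypergraph V E) (F : {set E}) (X : {set V})
  (P : {set {set V}}).

Definition hconnected H : bool :=
  [forall X : {set V}, (X != set0) && (X \proper verts H) ==>
    [exists e in edges H,
      (ends H e :&: X != set0) && (ends H e :&: (verts H :\: X) != set0)]].

(* The parts of P that a hyperedge meets. *)
Definition parts_meeting P X : {set {set V}} := [set B in P | B :&: X != set0].

Definition crossing H P : {set E} :=
  [set e in edges H | (2 <= #|parts_meeting P (ends H e)|)%N].

Definition partition_connected H : Prop :=
  forall P, partition P (verts H) -> (#|P| - 1 <= #|crossing H P|)%N.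

Lemma edge_sub_subproof H F e : e \in edges H :&: F ->
  ends H e \subset \bigcup_(f in edges H :&: F) ends H f.
Proof. by move=> he; exact: bigcup_sup. Qed.

Lemma edge_card_subproof H F e : e \in edges H :&: F -> (2 <= #|ends H e|)%N.
Proof. by case/setIP => he _; exact: ends_card. Qed.

(* H[F], for F a set of hyperedges of H. *)
Definition edge_sub H F : hypergraph V E :=
  Hypergraph (@edge_sub_subproof H F) (@edge_card_subproof H F).

Lemma vert_sub_subproof H X e : e \in [set f in edges H | ends H f \subset X] ->
  ends H e \subset X.
Proof. by rewrite inE => /andP[]. Qed.

Lemma vert_card_subproof H X e :
  e \in [set f in edges H | ends H f \subset X] -> (2 <= #|ends H e|)%N.
Proof. by rewrite inE => /andP[he _]; exact: ends_card. Qed.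

(* The subhypergraph with vertex set X and all the hyperedges inside X. *)
Definition vert_sub H X : hypergraph V E :=
  Hypergraph (@vert_sub_subproof H X) (@vert_card_subproof H X).

(* The vertex sets V_i of the connected components of H, i.e. of its maximal
   connected subhypergraphs; the component itself is vert_sub H V_i. *)
Definition component_sets H : {set {set V}} :=
  [set X | maxset (fun Y : {set V} =>
    [&& Y \subset verts H, Y != set0 & hconnected (vert_sub H Y)]) X].

Lemma quotient_sub_subproof H P e :
  e \in crossing H P -> parts_meeting P (ends H e) \subset P.
Proof. by move=> _; rewrite /parts_meeting setIdE finset.subsetIl. Qed.

Lemma quotient_card_subproof H P e :
  e \in crossing H P -> (2 <= #|parts_meeting P (ends H e)|)%N.
Proof. by rewrite inE => /andP[]. Qed.

(* For P a partition of the vertex set: every part of P is merged into a single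
   vertex, and the resulting loops (the hyperedges inside a part) are removed. *)
Definition quotient_hypergraph H P : hypergraph {set V} E :=
  Hypergraph (@quotient_sub_subproof H P) (@quotient_card_subproof H P).

(* A vertex obtained by successive contractions is encoded as the set of the
   vertices of H merged into it; contracting a hyperedge with ends X then
   replaces the parts that X meets by their union. *)
Definition merge_parts P X : {set {set V}} :=
  cover (parts_meeting P X) |: (P :\: parts_meeting P X).

(* H/F: the hyperedges of F are contracted one after the other, starting from
   H itself, whose vertices are the singletons. *)
Definition hcontract H F : hypergraph {set V} E :=
  quotient_hypergraph H
    (foldl (fun P f => merge_parts P (ends H f)) [set [set v] | v in verts H]
           (enum F)).

Definition hyperforest H F : bool :=
  (F \subset edges H) &&
  [forall X : {set V}, (X != set0) && (X \subset verts H) ==>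
    (#|[set e in F | ends H e \subset X]| <= #|X| - 1)%N].

Definition hypertree H F : bool :=
  hyperforest H F && (#|F| == #|verts H| - 1)%N.

End Hypergraphs.

Section Modulus.
Variables (R : realType) (E : finType).
Implicit Types (D : {set E}) (G : set {ffun E -> R}) (rho : {ffun E -> R}).

(* For D a subset of E, the space R^D is the subspace of R^E of the vectors
   that vanish outside D. *)
Definition orthant D : set {ffun E -> R} :=
  [set rho | (forall e, 0 <= rho e) /\
             (forall e, e \notin D -> rho e = 0)]%classic.

Definition restrict_vec D rho : {ffun E -> R} :=
  [ffun e => if e \in D then rho e else 0].

Definition Adm D G : set {ffun E -> R} :=
  [set rho | orthant D rho /\
     forall gamma, G gamma -> 1 <= \sum_(e in D) gamma e * rho e]%classic.

Definition extreme_points G : set {ffun E -> R} :=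
  [set x | G x /\ forall (y z : {ffun E -> R}) (t : R),
     G y -> G z -> 0 < t < 1 ->
     (forall e, x e = t * y e + (1 - t) * z e) ->
     y = x /\ z = x]%classic.

(* The Fulkerson blocker family of G, as a family in R^D. *)
Definition blocker D G : set {ffun E -> R} := extreme_points (Adm D G).

Definition energy D rho : R := \sum_(e in D) rho e ^+ 2.

Definition Mod2 D G : \bar R :=
  ereal_inf [set (energy D rho)%:E | rho in Adm D G]%classic.

Definition minimizer D G rho : Prop :=
  Adm D G rho /\ forall sigma, Adm D G sigma -> energy D rho <= energy D sigma.

Definition optimal_density D G rho : Prop := unique (minimizer D G) rho.

Definition hypertrees (V : finType) (H : hypergraph V E) : set {ffun E -> R} :=
  [set [ffun e => (e \in F)%:R] | F in [set F | hypertree H F]]%classic.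

Definition blocker_hypertrees (V : finType) (H : hypergraph V E) :
    set {ffun E -> R} :=
  blocker (edges H) (hypertrees H).

Definition argmax_edges D rho : {set E} :=
  [set e in D | [forall f in D, rho f <= rho e]].

End Modulus.

Arguments hypertrees R {E V} H.
Arguments blocker_hypertrees R {E V} H.

(* Main.v *)
(* A nonnegative x is admissible for the blocker of the hypertrees iff
   \sum_(e in delta(P)) min (x e, 1) >= |P| - 1 for every vertex partition P
   (x is then called strong below).  One direction tests x against normalized
   indicators of subsets of delta(P); the other compares x with a hypertree T of
   minimum weight along the level sets of the weight, where the maximal tight
   sets of T restricted to a sublevel set form a partition computing its rank.

   For the optimal eta, first-order optimality makes a minimum eta-weight
   hypertree reach equality in this comparison.  At the level just below the
   maximum, equality together with eta <= 1 yields a partition P with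
   delta(P) = Emax, eta(Emax) = |P| - 1 and all parts tight, hence spanned by
   E - Emax.  So P is the partition produced by the contraction, and its
   nontrivial parts are the components.  A better density on a part could be
   glued into eta, and on the quotient eta is constant with the least possible
   sum, so its energy is minimal by Cauchy-Schwarz. *)
Require Import Defs.
From mathcomp Require Import all_boot all_order all_algebra.
From mathcomp Require Import all_classical all_reals ereal.
From mathcomp Require Import finset.
From mathcomp Require Import zify ring lra.
Set Implicit Arguments.
Unset Strict Implicit.
Unset Printing Implicit Defensive.
Import Order.TTheory GRing.Theory Num.Theory.
Local Open Scope ring_scope.

Ltac nat_lia :=
  repeat match goal with H : ?P |- _ =>
    lazymatch P with
    | is_true (leq _ _) => fail
    | @eq nat _ _ => fail
    | _ => clear H
    end
  end; lia.

(** * Partitions of a finite set: parts met by a set, merging, restriction *)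

Section SetPartitions.
Variable T : finType.
Implicit Types (P Q : {set {set T}}) (A B D X : {set T}).

Lemma partition_intro P D :
  (forall B, B \in P -> B != set0 /\ B \subset D) ->
  (forall x, x \in D -> exists2 B, B \in P & x \in B) ->
  (forall A B x, A \in P -> B \in P -> x \in A -> x \in B -> A = B) ->
  partition P D.
Proof.
move=> hP hD hAB; apply/and3P; split.
- apply/eqP/setP => x; apply/bigcupP/idP => [[B /hP[_ /fintype.subsetP] h /h]//|].
  exact: hD.
- apply/trivIsetP => A B PA PB; apply: contraR => /pred0Pn[x /andP[/= xA xB]].
  by apply/eqP; apply: hAB xA xB.
- by apply/negP => /hP[/eqP].
Qed.

Lemma partition_memP P D x : partition P D -> x \in D ->
  exists2 B, B \in P & x \in B.
Proof. by move=> hP; rewrite -(cover_partition hP) => /bigcupP. Qed.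

Lemma partition_eq P D A B x : partition P D ->
  A \in P -> B \in P -> x \in A -> x \in B -> A = B.
Proof.
move=> /partition_trivIset tP PA PB xA xB.
by rewrite -(def_pblock tP PA xA) (def_pblock tP PB xB).
Qed.

Lemma partition_disjoint P Q D A : partition P D -> Q \subset P ->
  A \in P -> A \notin Q -> [disjoint A & cover Q].
Proof.
move=> hP /fintype.subsetP QP PA; apply: contraR => /pred0Pn[x /andP[/= xA]].
by move=> /bigcupP[B BQ xB]; rewrite (partition_eq hP PA (QP _ BQ) xA xB).
Qed.

Lemma partition_singletons D : partition [set [set v] | v in D] D.
Proof.
apply: partition_intro => [B /imsetP[v vD ->]|x xD|A B x].
- by rewrite -cards_eq0 cards1 sub1set.
- by exists [set x]; rewrite ?imset_f ?set11.
- by move=> /imsetP[v _ ->] /imsetP[w _ ->] /set1P -> /set1P ->.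
Qed.

Lemma card_singletons D : #|[set [set v] | v in D]| = #|D|.
Proof. by rewrite card_imset //; exact: finset.set1_inj. Qed.

Lemma parts_meetingP P X B :
  reflect (B \in P /\ exists2 v, v \in B & v \in X) (B \in parts_meeting P X).
Proof.
rewrite inE; apply: (iffP andP) => -[-> h]; split=> //.
  by case/set0Pn: h => v /setIP[]; exists v.
by case: h => v vB vX; apply/set0Pn; exists v; rewrite inE vB.
Qed.

Lemma parts_meeting_sub P X : parts_meeting P X \subset P.
Proof. by apply/fintype.subsetP => B /parts_meetingP[]. Qed.

Lemma cover_parts_meeting P D X : partition P D -> X \subset D ->
  X \subset cover (parts_meeting P X).
Proof.
move=> hP /fintype.subsetP XD; apply/fintype.subsetP => x xX.
have [B PB xB] := partition_memP hP (XD _ xX).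
by apply/bigcupP; exists B => //; apply/parts_meetingP; split=> //; exists x.
Qed.

Lemma merge_partsP P X B : reflect
  (B = cover (parts_meeting P X) \/ B \in P /\ B \notin parts_meeting P X)
  (B \in merge_parts P X).
Proof.
rewrite !inE; apply: (iffP orP) => -[].
- by move/eqP; left.
- by case/andP; right.
- by move=> ->; left.
- by case=> -> ->; right.
Qed.

Lemma merge_partition P D X : partition P D -> X \subset D -> X != set0 ->
  partition (merge_parts P X) D.
Proof.
move=> hP XD X0.
have XP := parts_meeting_sub P X.
have := cover_parts_meeting hP XD.
have disj A := partition_disjoint hP XP (A := A).
have cD : cover (parts_meeting P X) \subset D.
  rewrite -(cover_partition hP); apply/bigcupsP => B /(fintype.subsetP XP) PB.
  exact: bigcup_sup.
move=> XC; apply: partition_intro => [B|x xD|A B x].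
- move=> /merge_partsP[->|[PB _]]; last first.
    by rewrite (partition_neq0 hP PB) (partitionS hP PB).
  split=> //; apply: contra_neq X0 => c0; move: XC.
  by rewrite c0 finset.subset0 => /eqP.
- have [B PB xB] := partition_memP hP xD.
  case: (boolP (B \in parts_meeting P X)) => hB.
    exists (cover (parts_meeting P X)); first by apply/merge_partsP; left.
    by apply/bigcupP; exists B.
  by exists B => //; apply/merge_partsP; right.
- move=> /merge_partsP[->|[PA hA]] /merge_partsP[->|[PB hB]] //.
  + by move=> xc xB; have /pred0P/(_ x) := disj _ PB hB; rewrite /= xB xc.
  + by move=> xB xc; have /pred0P/(_ x) := disj _ PA hA; rewrite /= xB xc.
  + exact: partition_eq hP PA PB.
Qed.

(** The parts met by [X] become one, and this one differs from every untouched part because it meets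
    [X]. *)
Lemma card_merge_parts P D X : partition P D -> X \subset D -> X != set0 ->
  (#|merge_parts P X| + #|parts_meeting P X|)%N = #|P|.+1.
Proof.
move=> hP XD X0.
have := cardsID (parts_meeting P X) P.
rewrite (finset.setIidPr (parts_meeting_sub P X)) addnC => cardP.
rewrite /merge_parts cardsU1 -addnA cardP.
suff -> : cover (parts_meeting P X) \notin P :\: parts_meeting P X by [].
rewrite inE negb_and negbK; apply/orP.
case: (boolP (_ \in P)) => [cP|]; [left|by right].
apply/parts_meetingP; split=> //; have [x xX] := set0Pn _ X0; exists x => //.
by rewrite (fintype.subsetP (cover_parts_meeting hP XD)).
Qed.

Lemma restrict_partition P D X : partition P D -> X \subset D ->
  partition [set B :&: X | B in parts_meeting P X] X /\
  #|[set B :&: X | B in parts_meeting P X]| = #|parts_meeting P X|.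
Proof.
move=> hP XD; split; last first.
  apply: card_in_imset => A B /parts_meetingP[PA [v vA vX]].
  move=> /parts_meetingP[PB _] /setP/(_ v); rewrite !inE vA vX /= andbT => /esym.
  exact: partition_eq hP PA PB vA.
apply: partition_intro => [_ /imsetP[B /parts_meetingP[PB [v vB vX]] ->]|x xX|].
- by rewrite finset.subsetIr; split=> //; apply/set0Pn; exists v; rewrite inE vB.
- have [B PB xB] := partition_memP hP (fintype.subsetP XD _ xX).
  exists (B :&: X); last by rewrite inE xB.
  by apply: imset_f; apply/parts_meetingP; split=> //; exists x.
- move=> A0 B0 x /imsetP[A /parts_meetingP[PA _] ->].
  move=> /imsetP[B /parts_meetingP[PB _] ->] /setIP[xA _] /setIP[xB _].
  by rewrite (partition_eq hP PA PB xA xB).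
Qed.

Lemma partition2 D X : X != set0 -> X \proper D ->
  partition [set X; D :\: X] D /\ #|[set X; D :\: X]| = 2%N.
Proof.
move=> X0 /properP[XD [v vD vX]].
have ne : X != D :\: X.
  case/set0Pn: X0 => x xX; apply/eqP => /setP/(_ x); rewrite !inE xX.
  by rewrite (fintype.subsetP XD).
split; last by rewrite cards2 ne.
apply: partition_intro => [B /set2P[]-> //|x xD|A B x].
- by rewrite finset.subsetDl; split=> //; apply/set0Pn; exists v; rewrite inE vX.
- case: (boolP (x \in X)) => xX; first by exists X; rewrite ?set21.
  by exists (D :\: X); rewrite ?set22 // inE xX.
- by move=> /set2P[]-> /set2P[]-> //; rewrite !inE => h1; rewrite ?h1 // => h2;
    move: h1; rewrite h2.
Qed.

End SetPartitions.

(** * Hyperedges crossing a partition, and sums split by parts *)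

Section Crossing.
Variables (V E : finType) (H : hypergraph V E).
Implicit Types (P : {set {set V}}) (X : {set V}) (A T : {set E}).

Lemma ends_neq0 e : e \in edges H -> ends H e != set0.
Proof. by move/ends_card; rewrite -card_gt0 => /ltnW. Qed.

Lemma notin_crossing P e : partition P (verts H) -> e \in edges H ->
  (e \notin crossing H P) = [exists X in P, ends H e \subset X].
Proof.
move=> hP eE; have [v ve] := set0Pn _ (ends_neq0 eE).
have sub := fintype.subsetP (ends_sub eE).
rewrite inE eE /= -ltnNge ltnS; apply/idP/exists_inP => [le1|[X PX eX]].
  have [B PB vB] := partition_memP hP (sub _ ve).
  exists B => //; apply/fintype.subsetP => w we.
  have [C PC wC] := partition_memP hP (sub _ we).
  suff <- : C = B by [].
  have /card_le1_eqP := le1; apply; apply/parts_meetingP; split=> //;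
    by [exists v | exists w].
rewrite -(cards1 X) subset_leq_card //; apply/fintype.subsetP => B.
move=> /parts_meetingP[PB [w wB we]]; apply/set1P.
exact: partition_eq hP PB PX wB (fintype.subsetP eX _ we).
Qed.

Lemma crossing_sub P : crossing H P \subset edges H.
Proof. by apply/fintype.subsetP => e; rewrite inE => /andP[]. Qed.

Lemma crossing_anti P P' : partition P (verts H) -> partition P' (verts H) ->
  (forall X, X \in P -> exists2 Y, Y \in P' & X \subset Y) ->
  crossing H P' \subset crossing H P.
Proof.
move=> hP hP' h; apply/fintype.subsetP => e eP'.
have eE := fintype.subsetP (crossing_sub P') _ eP'.
apply: contraTT eP'; rewrite !notin_crossing // => /exists_inP[X /h[Y PY XY] eX].
by apply/exists_inP; exists Y => //; apply: fintype.subset_trans XY.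
Qed.

Definition inside A X : {set E} := [set e in A | ends H e \subset X].

(** A hyperedge that does not cross lies in some part, and in only one because it is nonempty. A
    general commutative monoid covers both cardinalities and energies. *)
Lemma big_partition_edges (R : Type) (idx : R) (op : Monoid.com_law idx)
    P A (w : E -> R) : partition P (verts H) -> A \subset edges H ->
  \big[op/idx]_(e in A) w e =
  op (\big[op/idx]_(X in P) \big[op/idx]_(e in inside A X) w e)
     (\big[op/idx]_(e in A :&: crossing H P) w e).
Proof.
move=> hP AE; rewrite (big_setID (crossing H P)) /= Monoid.mulmC.
congr (op _ _); rewrite (exchange_big_dep (mem (A :\: crossing H P))) /=.
  apply: eq_bigr => e; rewrite inE => /andP[ecr eA].
  have eE := fintype.subsetP AE _ eA.
  have := ecr; rewrite notin_crossing // => /exists_inP[X PX eX].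
  rewrite (big_pred1 X) // => Y; rewrite inE eA /=; apply/andP/eqP => [[PY eY]|-> //].
  have [v ve] := set0Pn _ (ends_neq0 eE).
  exact: partition_eq hP PY PX (fintype.subsetP eY _ ve) (fintype.subsetP eX _ ve).
move=> X e PX; rewrite inE => /andP[eA eX]; rewrite inE eA andbT.
by rewrite notin_crossing ?(fintype.subsetP AE) //; apply/exists_inP; exists X.
Qed.

Lemma card_partition_edges P A : partition P (verts H) -> A \subset edges H ->
  #|A| = (\sum_(X in P) #|inside A X| + #|A :&: crossing H P|)%N.
Proof.
move=> hP AE; rewrite -sum1_card (big_partition_edges _ _ hP AE) /=.
by rewrite -sum1_card; congr addn; apply: eq_bigr => X _; rewrite sum1_card.
Qed.

Lemma sum_card_pred P D : partition P (D : {set V}) ->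
  (\sum_(X in P) (#|X| - 1) + #|P| = #|D|)%N.
Proof.
move=> hP; rewrite (card_partition hP) -[#|P|]sum1_card -big_split /=.
by apply: eq_bigr => X PX; rewrite subnK // card_gt0 (partition_neq0 hP PX).
Qed.

End Crossing.

(** * The hypergraphic matroid: tight sets, rank formula, exchange *)

Section Hyperforests.
Variables (V E : finType) (H : hypergraph V E).
Implicit Types (P : {set {set V}}) (X Y : {set V}) (A T : {set E}).

Lemma hyperforestP T : reflect
  (T \subset edges H /\ forall X, X != set0 -> X \subset verts H ->
     (#|inside H T X| <= #|X| - 1)%N)
  (hyperforest H T).
Proof.
apply: (iffP andP) => -[TE h]; split=> //.
  by move=> X X0 XV; have /forall_inP := h; apply; rewrite X0.
by apply/forall_inP => X /andP[X0 XV]; apply: h.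
Qed.

Lemma inside_mono T A X : T \subset A -> inside H T X \subset inside H A X.
Proof.
move=> /fintype.subsetP TA; apply/fintype.subsetP => e.
by rewrite !inE => /andP[/TA -> ->].
Qed.

Lemma hyperforestS T A : T \subset A -> hyperforest H A -> hyperforest H T.
Proof.
move=> TA /hyperforestP[AE h]; apply/hyperforestP; split.
  exact: fintype.subset_trans AE.
by move=> X X0 XV; apply: leq_trans (h X X0 XV); rewrite subset_leq_card ?inside_mono.
Qed.

Lemma hyperforest0 : hyperforest H set0.
Proof.
apply/hyperforestP; split=> [|X _ _]; first exact: sub0set.
suff -> : inside H set0 X = set0 by rewrite cards0.
by apply/setP => e; rewrite !inE.
Qed.

(** For a hyperforest the opposite inequality always holds, so these are the sets on which its
    defining bound is attained. *)
Definition tight T X :=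
  [&& X != set0, X \subset verts H & (#|X| - 1 <= #|inside H T X|)%N].

Lemma tight_card T X : hyperforest H T -> tight T X -> #|inside H T X| = (#|X| - 1)%N.
Proof.
move=> /hyperforestP[_ h] /and3P[X0 XV hX]; apply/eqP.
by rewrite eqn_leq hX h.
Qed.

(** Uncrossing: the number of hyperedges of [T] inside a set is supermodular and the cardinal is
    modular, so the bounds for union and intersection are both attained. *)
Lemma tight_setUI T X Y : hyperforest H T -> tight T X -> tight T Y ->
  X :&: Y != set0 -> tight T (X :|: Y) /\ tight T (X :&: Y).
Proof.
move=> hT tX tY XY0; have [_ h] := hyperforestP _ hT.
have [/and3P[X0 XV _] /and3P[Y0 YV _]] := (tX, tY).
have U0 : X :|: Y != set0.
  by rewrite -card_gt0 (leq_trans _ (subset_leq_card (finset.subsetUl X Y))) ?card_gt0.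
have UV : X :|: Y \subset verts H by rewrite finset.subUset XV.
have IV : X :&: Y \subset verts H by apply: fintype.subset_trans XV; exact: finset.subsetIl.
have := cardsUI (inside H T X) (inside H T Y).
rewrite (tight_card hT tX) (tight_card hT tY).
have -> : inside H T X :&: inside H T Y = inside H T (X :&: Y).
  by apply/setP => e; rewrite !inE finset.subsetI andbACA andbb.
have : (#|inside H T X :|: inside H T Y| <= #|inside H T (X :|: Y)|)%N.
  rewrite subset_leq_card //; apply/fintype.subsetP => e; rewrite !inE -andb_orr.
  case/andP=> -> /orP[] h'; apply: fintype.subset_trans h' _.
    exact: finset.subsetUl.
  exact: finset.subsetUr.
move: (h _ U0 UV) (h _ XY0 IV) (cardsUI X Y) (XY0) (X0) (Y0) (U0).
rewrite /tight UV IV -!card_gt0 /=.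
move: #|X| #|Y| #|X :|: Y| #|X :&: Y| #|inside H T (X :|: Y)|.
move: #|inside H T (X :&: Y)| #|inside H T X :|: inside H T Y| => g k [|a] [|b] [|c] [|d] // l.
by rewrite !subn1 /= => *; split; nat_lia.
Qed.

Lemma inside_setU1 T e X : inside H (e |: T) X =
  if ends H e \subset X then e |: inside H T X else inside H T X.
Proof.
apply/setP => f; rewrite !inE; case: ifPn => eX; rewrite !inE.
  by case: eqVneq => [->|]; rewrite ?eX.
by case: eqVneq => [->|] //=; rewrite (negbTE eX) andbF.
Qed.

(** Adding [e] raises the count only inside sets containing its ends, so the bound fails exactly at
    a tight one. *)
Lemma hyperforestU1 T e : hyperforest H T -> e \in edges H -> e \notin T ->
  hyperforest H (e |: T) =
  [forall X, tight T X ==> ~~ (ends H e \subset X)].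
Proof.
move=> hT eE eT; have [TE h] := hyperforestP _ hT.
apply/hyperforestP/forall_inP => [[_ h'] X tX|h'].
  apply/negP => eX; have /and3P[X0 XV hX] := tX.
  have := h' _ X0 XV; rewrite inside_setU1 eX cardsU1 (tight_card hT tX).
  by rewrite inE (negbTE eT) /=; move: X0; rewrite -card_gt0; nat_lia.
split=> [|X X0 XV]; first by rewrite finset.subUset sub1set eE.
rewrite inside_setU1; case: ifP => eX; last exact: h.
have : ~~ tight T X by apply/negP => /h'; rewrite eX.
rewrite /tight X0 XV /= -ltnNge cardsU1 inE (negbTE eT) /=.
by move=> hX; rewrite add1n.
Qed.

Lemma tight1 T v : v \in verts H -> tight T [set v].
Proof. by move=> vV; rewrite /tight sub1set vV cards1 -card_gt0 cards1. Qed.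

(** Take the maximal tight sets: they cover since singletons are tight, and by uncrossing two that
    meet are equal. *)
Lemma tight_partition T : hyperforest H T -> exists P,
  [/\ partition P (verts H), forall X, X \in P -> tight T X &
      forall Y, tight T Y -> exists2 X, X \in P & Y \subset X].
Proof.
move=> hT; exists [set X | maxset (tight T) X].
have max Y : tight T Y -> exists2 X, X \in [set X | maxset (tight T) X] & Y \subset X.
  by move=> /maxset_exists[X mX YX]; exists X; rewrite ?inE.
split=> // [|X]; last by rewrite inE => /maxsetp.
apply: partition_intro => [B|x xV|A B x].
- by rewrite inE => /maxsetp/and3P[].
- have [X XP xX] := max _ (tight1 T xV).
  by exists X => //; rewrite -sub1set.
rewrite !inE => mA mB xA xB.
have [|tU _] := tight_setUI hT (maxsetp mA) (maxsetp mB).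
  by apply/set0Pn; exists x; rewrite inE xA.
rewrite -(maxsetsup mA tU (finset.subsetUl A B)).
exact: maxsetsup mB tU (finset.subsetUr A B).
Qed.

(** Maximality puts every hyperedge of [A] outside [T] into a tight set, hence into a part, so all
    crossing hyperedges of [A] belong to [T]. Counting [T] over the tight parts gives the rank
    formula. *)
Lemma rank_partition T A : hyperforest H T -> T \subset A -> A \subset edges H ->
  (forall e, e \in A -> e \notin T -> ~~ hyperforest H (e |: T)) ->
  exists P, [/\ partition P (verts H), forall X, X \in P -> tight T X,
     A :&: crossing H P \subset T &
     (#|T| + #|P| = #|verts H| + #|A :&: crossing H P|)%N].
Proof.
move=> hT TA AE mT; have [P [hP tP maxP]] := tight_partition hT.
have crT : A :&: crossing H P \subset T.
  apply/fintype.subsetP => e /setIP[eA]; apply: contraTT => eT.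
  have eE := fintype.subsetP AE _ eA.
  have := mT _ eA eT; rewrite hyperforestU1 // => /forall_inPn[Y tY].
  rewrite negbK notin_crossing // => eY; have [X PX YX] := maxP _ tY.
  by apply/exists_inP; exists X => //; apply: fintype.subset_trans YX.
exists P; split=> //.
rewrite (card_partition_edges hP (fintype.subset_trans TA AE)) -(sum_card_pred hP).
have -> : T :&: crossing H P = A :&: crossing H P.
  apply/eqP; rewrite finset.eqEsubset setSI // finset.subsetI crT.
  exact: finset.subsetIr.
rewrite (eq_bigr (fun X => #|X| - 1)%N) => [|X PX]; last exact/tight_card/tP.
by rewrite addnAC.
Qed.

Lemma maximal_hyperforest A : exists T, [/\ hyperforest H T, T \subset A &
  forall e, e \in A -> e \notin T -> ~~ hyperforest H (e |: T)].
Proof.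
have /maxset_exists[T mT _] : [pred T | hyperforest H T && (T \subset A)] set0.
  by rewrite /= hyperforest0 sub0set.
have /andP[hT TA] := maxsetp mT; exists T; split=> // e eA eT; apply/negP => he.
have /(_ _)/setP/(_ e) := maxsetsup mT _ (finset.subsetUr [set e] T).
rewrite !inE eqxx (negbTE eT) /= he finset.subUset sub1set eA TA.
by move=> /(_ isT).
Qed.

(** Each part contains at most [#|X| - 1] hyperedges of [T]; the rest must cross. *)
Lemma hypertree_crossing T P : hypertree H T -> partition P (verts H) ->
  (#|P| <= #|T :&: crossing H P| + 1)%N.
Proof.
move=> /andP[hT /eqP cT] hP; have [TE h] := hyperforestP _ hT.
have := card_partition_edges hP TE; rewrite cT -(sum_card_pred hP).
have : (\sum_(X in P) #|inside H T X| <= \sum_(X in P) (#|X| - 1))%N.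
  by apply: leq_sum => X PX; rewrite h ?(partition_neq0 hP PX) ?(partitionS hP PX).
nat_lia.
Qed.

Lemma hypertree_partition_connected T : hypertree H T -> partition_connected H.
Proof.
move=> hT P hP; rewrite leq_subLR addnC.
apply: leq_trans (hypertree_crossing hT hP) _.
by rewrite leq_add2r subset_leq_card // finset.subsetIr.
Qed.

(** For a maximal hyperforest the rank formula reads |T| = |V| - |P| + |delta(P)|, which
    partition-connectivity makes at least |V| - 1. *)
Lemma exists_hypertree : (0 < #|verts H|)%N -> partition_connected H ->
  exists T, hypertree H T.
Proof.
move=> V0 pc; have [T [hT TE mT]] := maximal_hyperforest (edges H).
exists T; rewrite /hypertree hT /=.
have [P [hP _ _]] := rank_partition hT TE (fintype.subxx _) mT.
rewrite (finset.setIidPr (crossing_sub H P)) => cT.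
have [_ /(_ (verts H))] := hyperforestP _ hT.
rewrite -card_gt0 V0 fintype.subxx => /(_ isT isT).
have -> : inside H T (verts H) = T.
  apply/setP => e; rewrite inE; case: (boolP (e \in T)) => //= eT.
  by rewrite ends_sub // (fintype.subsetP TE).
by move=> le; rewrite eqn_leq le /=; have := pc _ hP; nat_lia.
Qed.

(* Any edge f of the least tight set containing e can be exchanged for e; since
   that set is not tight for T :&: A, some such f lies outside A. *)
Lemma hypertree_exchange T A e : hypertree H T -> e \in edges H -> e \in A ->
  e \notin T -> hyperforest H (e |: (T :&: A)) ->
  exists f, [/\ f \in T, f \notin A & hypertree H (e |: (T :\ f))].
Proof.
move=> /andP[hT /eqP cT] eE eA eT hTe; have [TE h] := hyperforestP _ hT.
have tV : tight T (verts H).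
  rewrite /tight fintype.subxx -cT /= subset_leq_card ?andbT.
    have := ends_neq0 eE; rewrite -!card_gt0 => c0.
    exact: leq_trans c0 (subset_leq_card (ends_sub eE)).
  by apply/fintype.subsetP => f fT; rewrite inE fT ends_sub // (fintype.subsetP TE).
have /minset_exists[X mX _] : [pred Y | tight T Y && (ends H e \subset Y)] (verts H).
  by rewrite /= tV ends_sub.
have /andP[/= tX eX] := minsetp mX.
have minX Y : tight T Y -> ends H e \subset Y -> X \subset Y.
  move=> tY eY; have eXY : ends H e \subset X :&: Y by rewrite finset.subsetI eX.
  have [|_ tI] := tight_setUI hT tX tY.
    rewrite -card_gt0 (leq_trans _ (subset_leq_card eXY)) //.
    by rewrite card_gt0 ends_neq0.
  rewrite -(minsetinf mX (B := X :&: Y)) ?finset.subsetIr ?finset.subsetIl //=.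
  by rewrite tI.
have /subsetPn[f fX fA] : ~~ (inside H T X \subset inside H (T :&: A) X).
  apply/negP => sub; move: hTe; rewrite hyperforestU1 //; last first.
  - by rewrite inE (negbTE eT).
  - by apply: hyperforestS hT; exact: finset.subsetIl.
  move/forall_inP/(_ X); rewrite eX /tight; case/and3P: tX => -> -> c /(_ _)/negP.
  by apply => //; apply: leq_trans c (subset_leq_card sub).
move: fA (fX); rewrite !inE => fA /andP[fT fsX].
move: fA; rewrite fT fsX andbT /= => fA.
exists f; split=> //; apply/andP; split; last first.
  rewrite -cT cardsU1 !inE (negbTE eT) andbF /= add1n.
  by rewrite (cardsD1 f T) fT add1n.
have hTf : hyperforest H (T :\ f) by apply: hyperforestS hT; exact: finset.subsetDl.
rewrite hyperforestU1 // ?inE ?(negbTE eT) ?andbF //.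
(* A set [Y] tight for [T :\ f] and containing the ends of [e] is tight for [T], so it contains [X]
   and the ends of [f]; then [T] has more than [#|Y| - 1] hyperedges inside [Y]. *)
apply/forall_inP => Y /and3P[Y0 YV cY]; apply/negP => eY.
have sub : inside H (T :\ f) Y \subset inside H T Y.
  by apply: inside_mono; exact: finset.subsetDl.
have XY : X \subset Y.
  by apply: minX => //; rewrite /tight Y0 YV (leq_trans cY (subset_leq_card sub)).
have : inside H (T :\ f) Y \proper inside H T Y.
  apply/properP; split=> //; exists f; rewrite !inE ?eqxx ?fT //=.
  exact: fintype.subset_trans XY.
move/proper_card => lt; have := leq_trans lt (h _ Y0 YV); nat_lia.
Qed.

End Hyperforests.

(** * Weighted sums controlled by level sets *)

Section ThresholdSums.
Variables (R : realType) (E : finType).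
Implicit Types (D : {set E}) (rho d : E -> R).

(* Abel summation over the level sets of rho. *)
Lemma threshold_sum D rho d :
  (forall e, e \in D -> 0 <= rho e) ->
  (forall t, 0 <= t -> 0 <= \sum_(e in D | t < rho e) d e) ->
  0 <= \sum_(e in D) rho e * d e /\
  (\sum_(e in D) rho e * d e = 0 ->
   forall t, 0 <= t -> \sum_(e in D | t < rho e) d e = 0).
Proof.
have [n] := ubnP #|[set e in D | 0 < rho e]|.
elim: n => // n IH in rho *; rewrite ltnS => cn rho0 dpos.
have [S0|[e0 e0S]] := set_0Vmem [set e in D | 0 < rho e].
  have z e : e \in D -> rho e = 0.
    move=> eD; apply/eqP; rewrite eq_le rho0 // andbT leNgt; apply/negP => h.
    by have := finset.in_set0 e; rewrite -S0 inE eD h.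
  split=> [|_ t t0]; first by rewrite big1 // => e /z->; rewrite mul0r.
  by rewrite big1 // => e /andP[/z->]; rewrite ltNge t0.
pose e1 := [arg min_(e < e0 in [set e in D | 0 < rho e]) rho e]%O.
have [e1S e1min] : e1 \in [set e in D | 0 < rho e] /\
    forall e, e \in D -> 0 < rho e -> rho e1 <= rho e.
  rewrite /e1; case: arg_minP => // e eS emin; split=> // f fD f0.
  by apply: emin; rewrite inE fD.
move: (e1S); rewrite inE => /andP[e1D]; set m := rho e1 => m0.
(* Subtracting the least positive value [m] removes [e1] from the support, and the level set of
   [rho'] at [t] is that of [rho] at [t + m], so the hypotheses pass on to [rho']. *)
pose rho' e := Num.max 0 (rho e - m).
have lt' t e : 0 <= t -> (t < rho' e) = (t + m < rho e).
  by move=> t0; rewrite /rho' lt_max [t < 0]ltNge t0 /= ltrBrDr.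
have lower e : e \in D -> ~~ (0 < rho e) -> rho e = 0.
  by move=> eD h; apply/eqP; rewrite eq_le rho0 // andbT leNgt.
have split_sum : \sum_(e in D) rho e * d e =
    m * (\sum_(e in D | 0 < rho e) d e) + \sum_(e in D) rho' e * d e.
  rewrite mulr_sumr [X in X + _](big_mkcondr) /= -big_split /=.
  apply: eq_bigr => e eD; case: ifPn => [h|/(lower _ eD) h]; rewrite /rho'.
    have le : 0 <= rho e - m by rewrite subr_ge0 e1min.
    by rewrite max_r // mulrBl addrC subrK.
  by rewrite h sub0r max_l ?oppr_le0 ?(ltW m0) // mul0r addr0.
have [|||ge0 eq0] := IH rho' _ _ _.
- apply: leq_trans cn; apply: proper_card; apply/properP; split.
    apply/fintype.subsetP => e; rewrite !inE lt' // add0r => /andP[-> /=].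
    exact: lt_trans.
  by exists e1 => //; rewrite inE lt' // add0r ltxx andbF.
- by move=> e _; rewrite /rho' le_max lexx.
- move=> t t0; rewrite (eq_bigl (fun e => (e \in D) && (t + m < rho e))).
    by apply: dpos; rewrite addr_ge0 // ltW.
  by move=> e; rewrite lt'.
have S0ge : 0 <= m * (\sum_(e in D | 0 < rho e) d e).
  by rewrite mulr_ge0 ?(ltW m0) ?dpos.
split=> [|sum0 t t0]; first by rewrite split_sum addr_ge0.
move/eqP: sum0; rewrite split_sum paddr_eq0 // mulf_eq0 gt_eqF //=.
case/andP => /eqP s0 /eqP /eq0 s'.
have [tm|mt] := ltP t m.
  rewrite -[RHS]s0; apply: eq_bigl => e; apply: andb_id2l => eD.
  apply/idP/idP => h; first exact: le_lt_trans t0 h.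
  exact: lt_le_trans tm (e1min _ eD h).
have tm0 : 0 <= t - m by rewrite subr_ge0.
rewrite -[RHS](s' _ tm0); apply: eq_bigl => e; apply: andb_id2l => eD.
by rewrite lt' // subrK.
Qed.

End ThresholdSums.

(** * Extreme points of the polyhedron of admissible densities *)

Section ExtremePoints.
Variables (R : realType) (E I : finType) (D : {set E}) (Q : pred I).
Variable g : I -> {ffun E -> R}.
Implicit Types x y z d : {ffun E -> R}.

(** All constraints take the form [rhs j <= lin j x]: [inl e] is nonnegativity of the coordinate
    [e], [inr i] is admissibility against [g i]. *)
Let lin (j : E + I) (d : E -> R) : R :=
  match j with inl e => d e | inr i => \sum_(e in D) g i e * d e end.
Let rhs (j : E + I) : R := if j is inr _ then 1 else 0.
Let active (j : E + I) : bool :=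
  match j with inl e => e \in D | inr i => Q i end.

Let lin_comb j x y (a b : R) :
  lin j (fun e => a * x e + b * y e) = a * lin j x + b * lin j y.
Proof.
case: j => //= i; rewrite !mulr_sumr -big_split; apply: eq_bigr => e _ /=.
by rewrite mulrDr !mulrA ![g i e * _]mulrC.
Qed.

Let G : set {ffun E -> R} := [set g i | i in [set i | Q i]]%classic.

Let AdmP x : Adm D G x <->
  (forall j, active j -> rhs j <= lin j x) /\ (forall e, e \notin D -> x e = 0).
Proof.
split=> [[[x0 xD] xG]|[h xD]].
  by split=> // -[e _|i Qi] //=; apply: xG; exists i.
split; first split=> // e; last by move=> _ [i Qi <-]; apply: (h (inr i)).
by case: (boolP (e \in D)) => [/(h (inl e))//|/xD ->].
Qed.

(* From a non-extreme point, move along a segment direction d that does not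
   increase c and has a negative coordinate until a new constraint gets tight. *)
Lemma extreme_below (c : E -> R) x :
  (forall e, e \in D -> 0 <= c e) -> Adm D G x ->
  exists2 y, extreme_points (Adm D G) y &
    \sum_(e in D) c e * y e <= \sum_(e in D) c e * x e.
Proof.
move=> c0.
(* The number of constraints slack at the point is the induction measure. *)
pose loose y := [set j | active j & lin j y != rhs j].
have [n] := ubnP #|loose x|.
elim: n => // n IH in x *; rewrite ltnS => cn Ax.
have [ext|next] := pselect (extreme_points (Adm D G) x).
  by exists x.
(* A point that is not extreme lies strictly between two distinct admissible points; a constraint
   tight at [x] is tight at both, hence vanishes on their difference. *)
have [d [d0 dD dloose]] : exists d, [/\ exists e, d e != 0,
    forall e, e \notin D -> d e = 0 &
    forall j, active j -> lin j x = rhs j -> lin j d = 0].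
  apply: contrapT => nd; apply: next; split=> // y z t Ay Az /andP[t0 t1] xyz.
  have yz : y = z.
    apply: contrapT => yz; apply: nd; exists (y - z); split.
    - apply: contrapT => h; apply: yz; apply/ffunP => e.
      apply/eqP; rewrite -subr_eq0; apply: contrapT => /negP ne; apply: h.
      by exists e; rewrite !ffunE.
    - move=> e eD; rewrite !ffunE; have [_ /(_ _ eD)->] := (AdmP y).1 Ay.
      by have [_ /(_ _ eD)->] := (AdmP z).1 Az; rewrite subr0.
    - move=> j aj.
      have -> : lin j x = t * lin j y + (1 - t) * lin j z.
        rewrite -lin_comb; case: j aj => [e|i] _ /=; first exact: xyz.
        by apply: eq_bigr => e _; rewrite xyz.
      have -> : lin j (y - z) = lin j y - lin j z.
        transitivity (1 * lin j y + (-1) * lin j z); last by rewrite mul1r mulN1r.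
        rewrite -lin_comb; case: j aj => [e|i] _ /=; first by rewrite !ffunE mul1r mulN1r.
        by apply: eq_bigr => e _; rewrite !ffunE mul1r mulN1r.
      have [/(_ j aj) hy _] := (AdmP y).1 Ay; have [/(_ j aj) hz _] := (AdmP z).1 Az.
      move: (lin j y) (lin j z) (rhs j) hy hz => a b r hy hz h; nra.
  suff -> : x = z by rewrite yz.
  by apply/ffunP => e; rewrite xyz yz; ring.
(* The sign of [d] is chosen here. If the cost strictly drops, a negative coordinate exists because
   [c] is nonnegative; if the cost is unchanged, a nonzero coordinate decides the sign. *)
have [{d0 dD dloose}d [[e1 [e1D de1]] dD dloose cd]] : exists d,
    [/\ exists e, e \in D /\ d e < 0,
    forall e, e \notin D -> d e = 0,
    forall j, active j -> lin j x = rhs j -> lin j d = 0 &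
    \sum_(e in D) c e * d e <= 0].
  have linN j : lin j (- d) = - lin j d.
    transitivity ((-1) * lin j d + 0 * lin j d); last by rewrite mul0r addr0 mulN1r.
    rewrite -lin_comb; case: j => [e|i] /=; first by rewrite !ffunE mul0r addr0 mulN1r.
    by apply: eq_bigr => e _; rewrite !ffunE mul0r addr0 mulN1r.
  have cN : \sum_(e in D) c e * (- d) e = - \sum_(e in D) c e * d e.
    by rewrite -sumrN; apply: eq_bigr => e _; rewrite !ffunE mulrN.
  have ND e : e \notin D -> (- d) e = 0 by move=> /dD h; rewrite !ffunE h oppr0.
  have Nloose j : active j -> lin j x = rhs j -> lin j (- d) = 0.
    by move=> aj h; rewrite linN dloose // oppr0.
  have neg (b : E -> R) : \sum_(e in D) c e * b e < 0 -> exists e, e \in D /\ b e < 0.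
    move=> lt; apply: contrapT => h; move: lt; rewrite ltNge sumr_ge0 // => e eD.
    rewrite mulr_ge0 ?c0 // leNgt; apply/negP => be; apply: h; by exists e.
  have [lt|gt|eq] := ltgtP (\sum_(e in D) c e * d e) 0.
  - by exists d; split=> //; [exact: neg|exact: ltW].
  - exists (- d); split=> //; last by rewrite cN oppr_le0 ltW.
    by apply: neg; rewrite cN oppr_lt0.
  - have [e de] := d0; have eD : e \in D by apply: contraNT de => /dD ->.
    have [lt|gt|/eqP] := ltgtP (d e) 0; last by rewrite (negbTE de).
      by exists d; split=> //; [exists e|rewrite eq].
    exists (- d); split=> //; last by rewrite cN eq oppr0.
    by exists e; rewrite !ffunE oppr_lt0.
(* The step length at which constraint [j] becomes tight. The least one respects all constraints and
   makes [j0] tight, while tight ones stay so; the negative coordinate [e1] guarantees a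
   candidate. *)
pose ratio j := (lin j x - rhs j) / - lin j d.
pose j0 := [arg min_(j < (inl e1 : E + I) | active j && (lin j d < 0)) ratio j]%O.
have [/andP[aj0 dj0] j0min] : (active j0 && (lin j0 d < 0)) /\
    forall j, active j -> lin j d < 0 -> ratio j0 <= ratio j.
  rewrite /j0; case: arg_minP => [|j hj jmin]; first by rewrite /= e1D.
  by split=> // k ak dk; apply: jmin; rewrite ak.
have [xpos xD] := (AdmP x).1 Ax.
have s0 : 0 <= ratio j0.
  by rewrite /ratio divr_ge0 ?subr_ge0 ?xpos // oppr_ge0 ltW.
set s := ratio j0 in s0 j0min.
pose y : {ffun E -> R} := [ffun e => x e + s * d e].
have liny j : lin j y = lin j x + s * lin j d.
  transitivity (1 * lin j x + s * lin j d); last by rewrite mul1r.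
  rewrite -lin_comb; case: j => [e|i] /=; first by rewrite !ffunE mul1r.
  by apply: eq_bigr => e _; rewrite !ffunE mul1r.
have Ay : Adm D G y.
  apply/AdmP; split=> [j aj|e eD]; last by rewrite !ffunE xD // dD // mulr0 addr0.
  rewrite liny; have [dj|dj] := ltP (lin j d) 0; last first.
    by rewrite (le_trans (xpos _ aj)) // lerDl mulr_ge0.
  have := j0min _ aj dj; rewrite /ratio ler_pdivlMr ?oppr_gt0 //.
  by rewrite mulrN lerBrDr addrC lerBlDr.
have [|z ez cz] := IH y _ Ay.
  apply: leq_trans cn; apply: proper_card; apply/properP; split.
    apply/fintype.subsetP => j; rewrite !inE => /andP[aj]; rewrite aj /= liny.
    by apply: contra => /eqP h; rewrite (dloose _ aj h) mulr0 addr0 h.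
  exists j0; rewrite !inE aj0 /=.
    by apply: contraTneq dj0 => h; rewrite (dloose _ aj0 h) ltxx.
  rewrite liny negbK /s /ratio invrN mulrN mulNr divfK; last by rewrite lt_eqF.
  by rewrite opprB addrC subrK.
exists z => //; apply: le_trans cz _.
rewrite (eq_bigr (fun e => c e * x e + s * (c e * d e))); last first.
  by move=> e _; rewrite ffunE mulrDr mulrCA.
rewrite big_split /= -mulr_sumr gerDl mulr_ge0_le0 //.
Qed.

End ExtremePoints.

(** * Minimum-weight hypertrees and admissibility for the blocker *)

Section MinimalHypertree.
Variables (R : realType) (V E : finType) (H : hypergraph V E).
Implicit Types (P : {set {set V}}) (A T : {set E}) (rho x : E -> R).

Definition min_hypertree rho T : Prop := hypertree H T /\
  forall T', hypertree H T' -> \sum_(e in T) rho e <= \sum_(e in T') rho e.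

Lemma exists_min_hypertree rho : (0 < #|verts H|)%N -> partition_connected H ->
  exists T, min_hypertree rho T.
Proof.
move=> V0 pc; have [T0 hT0] := exists_hypertree V0 pc.
exists [arg min_(T < T0 | hypertree H T) \sum_(e in T) rho e]%O.
by case: arg_minP.
Qed.

Definition sublevel rho (t : R) := [set e in edges H | rho e <= t].

Lemma sublevel_sub rho t : sublevel rho t \subset edges H.
Proof. by apply/fintype.subsetP => e; rewrite inE => /andP[]. Qed.

(** Within the sublevel set [T] is a maximal hyperforest: otherwise an exchange would trade a
    hyperedge of weight above [t] for one of weight at most [t]. The rank formula then gives the
    count. *)
Lemma min_hypertree_rank rho T t : (0 < #|verts H|)%N -> min_hypertree rho T ->
  exists P, [/\ partition P (verts H),
    forall X, X \in P -> tight H (T :&: sublevel rho t) X &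
    (#|T :\: sublevel rho t| + #|sublevel rho t :&: crossing H P| + 1 = #|P|)%N].
Proof.
move=> V0 [hT minT]; have /andP[fT /eqP cT] := hT.
have fTA : hyperforest H (T :&: sublevel rho t).
  by apply: hyperforestS fT; exact: finset.subsetIl.
have [|P [hP tP crT cP]] :=
    rank_partition fTA (finset.subsetIr _ _) (sublevel_sub _ _).
  move=> e eA eT; have {}eT : e \notin T by apply: contra eT => eT; rewrite inE eT.
  apply/negP => he; have eE := fintype.subsetP (sublevel_sub rho t) _ eA.
  have [f [fT' fA hTf]] := hypertree_exchange hT eE eA eT he.
  have := minT _ hTf; rewrite big_setU1 /=; last by rewrite !inE (negbTE eT) andbF.
  rewrite (big_setD1 f fT') /= lerD2r leNgt => /negP; apply.
  have fE : f \in edges H.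
    by have [/fintype.subsetP sub _] := hyperforestP _ _ fT; exact: sub.
  move: eA fA; rewrite !inE fE /= -ltNge => /andP[_]; exact: le_lt_trans.
exists P; split=> //.
have := cardsID (sublevel rho t) T; move: cP cT V0; nat_lia.
Qed.

(* The truncation at 1 cannot be dropped: with three parallel hyperedges equal to
   a vertex set of size four, (3, 0, 0) would satisfy all the inequalities. *)
Definition strong x : Prop := forall P, partition P (verts H) ->
  #|P|%:R <= \sum_(e in crossing H P) Num.min (x e) 1 + 1.

Lemma sum_hypertree T (w : E -> R) : hypertree H T ->
  \sum_(e in edges H) w e * (e \in T)%:R = \sum_(e in T) w e.
Proof.
move=> /andP[/hyperforestP[/fintype.subsetP TE _] _].
rewrite [RHS](big_setID (edges H)) /= [X in _ = _ + X]big1 ?addr0 => [|e].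
  rewrite (big_setID T) /= addrC big1 ?add0r => [|e].
    by rewrite finset.setIC; apply: eq_bigr => e /setIP[-> _]; rewrite mulr1.
  by rewrite inE => /andP[/negbTE -> _]; rewrite mulr0.
by rewrite inE => /andP[/negP eE /TE].
Qed.

(** Threshold summation is applied to the truncated [x] minus the indicator of [T]. Each level
    inequality comes from strength at the rank partition of the sublevel set, and equal totals force
    equality at every level. *)
Lemma strong_min_hypertree rho T x : (0 < #|verts H|)%N ->
  min_hypertree rho T ->
  (forall e, e \in edges H -> 0 <= rho e) ->
  (forall e, e \in edges H -> 0 <= x e) -> strong x ->
  \sum_(e in T) rho e <= \sum_(e in edges H) rho e * Num.min (x e) 1 /\
  (\sum_(e in T) rho e = \sum_(e in edges H) rho e * Num.min (x e) 1 ->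
   forall t, 0 <= t ->
     \sum_(e in edges H | t < rho e) Num.min (x e) 1 =
     #|T :\: sublevel rho t|%:R).
Proof.
move=> V0 mT rho0 x0 sx; have [hT _] := mT.
have /andP[/hyperforestP[/fintype.subsetP TE _] _] := hT.
pose d e := Num.min (x e) 1 - (e \in T)%:R.
have thr t : \sum_(e in edges H | t < rho e) d e =
    \sum_(e in edges H | t < rho e) Num.min (x e) 1 - #|T :\: sublevel rho t|%:R.
  rewrite sumrB; congr (_ - _); rewrite -sum1_card natr_sum big_mkcond /=.
  rewrite [RHS]big_mkcond; apply: eq_bigr => e _; rewrite !inE.
  case: (boolP (e \in T)) => [/TE ->|_]; first by rewrite /= andbT -ltNge.
  by rewrite andbF; case: ifP.
have -> : \sum_(e in T) rho e = \sum_(e in edges H) rho e * (e \in T)%:R.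
  by rewrite sum_hypertree.
have dE : \sum_(e in edges H) rho e * d e =
    \sum_(e in edges H) rho e * Num.min (x e) 1 -
    \sum_(e in edges H) rho e * (e \in T)%:R.
  by rewrite -sumrB; apply: eq_bigr => e _; rewrite mulrBr.
have [|ge eq0] := threshold_sum (d := d) rho0.
  move=> t t0; rewrite thr subr_ge0.
  have [P [hP _ cP]] := min_hypertree_rank t V0 mT.
  have := sx _ hP; rewrite -cP !natrD lerD2r.
  rewrite (big_setID (sublevel rho t)) /= => le.
  (* Thanks to the truncation, crossing hyperedges of low weight contribute at most their number,
     which is the term to cancel in the rank count. *)
  have le1 : \sum_(e in crossing H P :&: sublevel rho t) Num.min (x e) 1 <=
      #|sublevel rho t :&: crossing H P|%:R.
    rewrite finset.setIC -sum1_card natr_sum; apply: ler_sum => e _.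
    by rewrite ge_min lexx orbT.
  have le2 : \sum_(e in crossing H P :\: sublevel rho t) Num.min (x e) 1 <=
      \sum_(e in edges H | t < rho e) Num.min (x e) 1.
    rewrite big_mkcond [leRHS]big_mkcond; apply: ler_sum => e _.
    rewrite !inE; case: (boolP (e \in edges H)) => eE /=; last by rewrite ?andbF.
    rewrite -ltNge; case: (t < rho e) => //=; case: ifP => // _.
    by rewrite le_min x0 //= ler01.
  lra.
rewrite dE in ge eq0; split=> [|h t t0]; first by rewrite -subr_ge0.
apply/eqP; rewrite -subr_eq0 -thr; apply/eqP/eq0 => //.
by rewrite h subrr.
Qed.

Lemma min_le (y : E -> R) e : Num.min (y e) 1 <= y e.
Proof. by rewrite ge_min lexx. Qed.

Lemma Adm_blocker (x : {ffun E -> R}) : (0 < #|verts H|)%N ->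
  partition_connected H ->
  Adm (edges H) (blocker_hypertrees R H) x <-> orthant (edges H) x /\ strong x.
Proof.
move=> V0 pc; split=> -[ox].
  move=> hx; split=> // P hP; have [x0 _] := ox.
  (* Hyperedges with value above 1 count as 1 after truncation; only those in [B] enter the test
     vector. *)
  pose A := [set e in crossing H P | x e > 1].
  pose B := [set e in crossing H P | x e <= 1].
  have inA e : (e \in A) = (e \in crossing H P) && (x e > 1) by rewrite inE.
  have inB e : (e \in B) = (e \in crossing H P) && (x e <= 1) by rewrite inE.
  have eqsum : \sum_(e in crossing H P) Num.min (x e) 1 = \sum_(e in B) x e + #|A|%:R.
    rewrite -sum1_card natr_sum [X in X + _]big_mkcond [X in _ + X]big_mkcond.
    rewrite -big_split big_mkcond; apply: eq_bigr => e _ /=; rewrite inA inB.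
    case: (boolP (e \in crossing H P)) => _ /=; last by rewrite addr0.
    by case: ltP => [lt|le]; rewrite ?addr0 ?add0r.
  rewrite eqsum.
  have [le|lt] := leqP #|P| (#|A| + 1)%N.
    have : 0 <= \sum_(e in B) x e by apply: sumr_ge0.
    by move: le; rewrite -(ler_nat R) natrD; lra.
  (* Every hypertree has at least [#|P| - 1] crossing hyperedges, hence at least [k] in [B], so the
     weight [k^-1] on [B] is admissible for the hypertrees. *)
  pose k : R := #|P|%:R - #|A|%:R - 1.
  have k0 : 0 < k by move: lt; rewrite -(ltr_nat R) natrD /k; lra.
  pose rho : {ffun E -> R} := [ffun e => if e \in B then k^-1 else 0].
  have BE : B \subset edges H.
    by apply/fintype.subsetP => e; rewrite !inE => /andP[/andP[]].
  have sumrho (w : E -> R) : \sum_(e in edges H) w e * rho e = k^-1 * \sum_(e in B) w e.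
    rewrite (big_setID B) /= (finset.setIidPr BE) [X in _ + X]big1 ?addr0 => [|e].
      by rewrite mulr_sumr; apply: eq_bigr => e eB; rewrite ffunE eB mulrC.
    by rewrite inE => /andP[/negbTE eB _]; rewrite ffunE eB mulr0.
  (* [rho] need not be extreme, so [x] is tested against an extreme point whose pairing with [x] is
     no larger. *)
  have [|y ey le] := @extreme_below R E _ (edges H) (hypertree H)
      (fun F => [ffun e => (e \in F)%:R]) x rho (fun e _ => x0 e).
    split; first split=> e; rewrite ?ffunE.
    - by case: ifP => // _; rewrite invr_ge0 ltW.
    - by move=> eE; case: ifP => // /(fintype.subsetP BE); rewrite (negbTE eE).
    move=> _ [T hT <-]; rewrite sumrho ler_pdivlMl // mulr1.
    rewrite (eq_bigr (fun e => (e \in T)%:R)) => [|e _]; last by rewrite ffunE.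
    suff : (#|P| <= \sum_(e in B) (e \in T) + #|A| + 1)%N.
      by rewrite -(ler_nat R) !natrD -natr_sum /k; lra.
    apply: leq_trans (hypertree_crossing hT hP) _.
    rewrite leq_add2r -sum1_card -[#|A|]sum1_card.
    rewrite big_mkcond [X in (_ <= X + _)%N]big_mkcond [X in (_ <= _ + X)%N]big_mkcond.
    rewrite -big_split; apply: leq_sum => e _ /=; rewrite finset.in_setI inA inB.
    by case: (e \in T); case: (e \in crossing H P) => //=; case: ltP.
  have := hx _ ey; rewrite (eq_bigr (fun e => x e * y e)) => [ge|e _]; last exact: mulrC.
  have := le_trans ge le; rewrite sumrho ler_pdivlMl // mulr1 /k; lra.
(* For the converse, a member [y] of the blocker serves as weight: its minimum hypertree weighs at
   least 1 and at most the pairing of [y] with [x]. *)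
move=> sx; split=> // y [[[y0 _] hy] _].
have [T mT] := exists_min_hypertree y V0 pc; have [hT _] := mT.
have [x0 _] := ox.
have [le _] := strong_min_hypertree V0 mT (fun e _ => y0 e) (fun e _ => x0 e) sx.
have := hy [ffun e => (e \in T)%:R]; rewrite (eq_bigr (fun e => y e * (e \in T)%:R)).
  rewrite sum_hypertree // => /(_ _)/le_trans; apply; first by exists T.
  by apply: le_trans le _; apply: ler_sum => e _; rewrite ler_wpM2l ?min_le.
by move=> e _; rewrite ffunE mulrC.
Qed.

Lemma Adm_hypertree T : hypertree H T ->
  Adm (edges H) (blocker_hypertrees R H) [ffun e => (e \in T)%:R].
Proof.
move=> hT; have /andP[/hyperforestP[TE _] _] := hT.
split; first split=> e; rewrite ?ffunE ?ler0n //.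
  move=> eE; suff /negbTE -> : e \notin T by [].
  by apply: contra eE; exact: (fintype.subsetP TE).
move=> y [[_ hy] _]; have := hy [ffun e => (e \in T)%:R]; move/(_ (ex_intro2 _ _ T hT erefl)).
by move=> le; rewrite (eq_bigr _ (fun e _ => mulrC _ _)).
Qed.

End MinimalHypertree.

(** * Minimizers of the energy: first-order condition and uniqueness *)

Section Minimizers.
Variables (R : realType) (E : finType) (D : {set E}) (G : set {ffun E -> R}).
Implicit Types eta sigma : {ffun E -> R}.

Lemma Mod2_minimizer eta : minimizer D G eta -> Mod2 D G = (energy D eta)%:E.
Proof.
move=> [Aeta min]; apply/eqP; rewrite eq_le; apply/andP; split.
  by apply: ereal_inf_lbound; exists eta.
by apply: le_ereal_inf_tmp => _ [s As <-]; rewrite lee_fin min.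
Qed.

(** The admissible set is convex, so on the segment from [eta] to [sigma] the energy never drops
    below its value at [eta]; its derivative there is twice the difference of the two sides. *)
Lemma minimizer_first_order eta sigma : minimizer D G eta -> Adm D G sigma ->
  energy D eta <= \sum_(e in D) eta e * sigma e.
Proof.
move=> [[[eta0 etaD] etaG] min] [[sig0 sigD] sigG].
set N := energy D eta; set S := \sum_(e in D) _; set M := energy D sigma.
have key (s : R) : 0 < s -> s <= 1 -> 0 <= 2 * (S - N) + s * (M - 2 * S + N).
  move=> s0 s1.
  have comb_ge0 (a b : R) : 0 <= a -> 0 <= b -> 0 <= (1 - s) * a + s * b.
    by move=> a0 b0; rewrite addr_ge0 // mulr_ge0 // ?subr_ge0 // ltW.
  have : Adm D G [ffun e => (1 - s) * eta e + s * sigma e].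
    split; first split=> e; rewrite ?ffunE; first exact: comb_ge0.
      by move=> eD; rewrite etaD ?sigD // !mulr0 addr0.
    move=> y Gy; rewrite (eq_bigr (fun e => (1 - s) * (y e * eta e) + s * (y e * sigma e))).
      rewrite big_split /= -!mulr_sumr.
      have := comb_ge0 (\sum_(e in D) y e * eta e - 1) (\sum_(e in D) y e * sigma e - 1).
      by rewrite !subr_ge0 => /(_ (etaG _ Gy) (sigG _ Gy)); lra.
    by move=> e _; rewrite ffunE; ring.
  move/min; rewrite -/N.
  have -> : energy D [ffun e => (1 - s) * eta e + s * sigma e] =
      (1 - s) ^+ 2 * N + 2 * (1 - s) * s * S + s ^+ 2 * M.
    rewrite /energy /N /S /M /energy !mulr_sumr -!big_split /=; apply: eq_bigr => e _.
    by rewrite ffunE; ring.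
  by move=> h; rewrite -(pmulr_rge0 _ s0); lra.
rewrite -subr_ge0 leNgt; apply/negP => neg.
set C := M - 2 * S + N in key.
have C0 : 0 < C by have := key 1 ltr01 (lexx _); lra.
(* With [s * C <= N - S] the bound [key] yields 0 <= S - N, against [neg]; the cap at 1 stays on the
   segment. *)
pose s := Num.min 1 ((N - S) / C).
have s0 : 0 < s by rewrite lt_min ltr01 divr_gt0 //; lra.
have s1 : s <= 1 by rewrite ge_min lexx.
have sC : s * C <= N - S by rewrite -ler_pdivlMr // ge_min lexx orbT.
by have := key s s0 s1; lra.
Qed.

(** The squared distance of two minimizers is twice the energy minus twice their pairing, which the
    first-order condition makes nonpositive. *)
Lemma minimizer_optimal eta : minimizer D G eta -> optimal_density D G eta.
Proof.
move=> meta; split=> // sigma msig.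
have [Ae mine] := meta; have [As mins] := msig.
have h := minimizer_first_order meta As.
have eqe := le_anti (introT andP (conj (mine _ As) (mins _ Ae))).
have : \sum_(e in D) (eta e - sigma e) ^+ 2 <= 0.
  have -> : \sum_(e in D) (eta e - sigma e) ^+ 2 =
      energy D eta + energy D sigma - 2 * \sum_(e in D) eta e * sigma e.
    rewrite /energy mulr_sumr -big_split -sumrB; apply: eq_bigr => e _ /=; ring.
  by rewrite -eqe; lra.
move=> le; have /eqP := le_anti (introT andP (conj le (sumr_ge0 _ (fun e _ => sqr_ge0 _)))).
rewrite psumr_eq0 => [/allP h0|e _]; last exact: sqr_ge0.
apply/ffunP => e; case: (boolP (e \in D)) => eD.
  have := h0 e (mem_index_enum e); rewrite eD /= sqrf_eq0 subr_eq0.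
  exact/eqP.
by have [[[_ ->]// _]] := (Ae, As); case: As => -[_ ->].
Qed.

End Minimizers.

(** * Partition-connectivity implies connectivity *)

Section Connectivity.
Variables (V E : finType) (H : hypergraph V E).
Implicit Types X : {set V}.

Lemma partition_connected_hconnected : partition_connected H -> hconnected H.
Proof.
move=> pc; apply/forall_inP => X /andP[X0 XV].
have [hP cP] := partition2 X0 XV.
have := pc _ hP; rewrite cP card_gt0 => /set0Pn[e]; rewrite inE => /andP[eE c2].
apply/exists_inP; exists e => //.
have /eqP pm : parts_meeting [set X; verts H :\: X] (ends H e) == [set X; verts H :\: X].
  by rewrite eqEcard parts_meeting_sub cP.
have := set21 X (verts H :\: X); rewrite -{1}pm inE => /andP[_].
have := set22 X (verts H :\: X); rewrite -{1}pm inE => /andP[_].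
by rewrite ![ends H e :&: _]finset.setIC => -> ->.
Qed.

Lemma hconnectedP X : hconnected H -> X != set0 -> X \proper verts H ->
  exists e v w, [/\ e \in edges H, v \in ends H e, v \in X,
    w \in ends H e & w \in verts H :\: X].
Proof.
move=> /forall_inP/(_ X) h X0 XV; have := h; rewrite X0 XV => /(_ isT).
move=> /exists_inP[e eE /andP[/set0Pn[v /setIP[ve vX]] /set0Pn[w /setIP[we wX]]]].
by exists e, v, w.
Qed.

End Connectivity.

(** * Contraction and connected components described by one partition *)

Section Components.
Variables (V E : finType) (H : hypergraph V E).
Implicit Types (P : {set {set V}}) (X Y : {set V}) (F T : {set E}).

Lemma edges_part_sub F X : F \subset edges H ->
  edges (vert_sub (edge_sub H F) X) = inside H F X.
Proof.
move=> /fintype.subsetP FE; apply/setP => e; rewrite !inE andbC [RHS]andbC.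
by case: (boolP (e \in F)) => [/FE ->|]; rewrite ?andbF.
Qed.

(** The hyperforest bound is inherited from [H], and tightness supplies the right number of
    hyperedges. This is what makes tight parts partition-connected. *)
Lemma tight_hypertree F T X : F \subset edges H -> T \subset F ->
  hyperforest H T -> tight H T X ->
  hypertree (vert_sub (edge_sub H F) X) (inside H T X).
Proof.
move=> FE TF hT tX; have [TE h] := hyperforestP _ _ hT.
have /and3P[X0 XV _] := tX.
apply/andP; split; last by rewrite (tight_card hT tX).
apply/hyperforestP; split=> [|Y Y0 YX].
  by rewrite edges_part_sub //; exact: inside_mono.
apply: leq_trans (h _ Y0 (fintype.subset_trans YX XV)).
rewrite subset_leq_card //; apply/fintype.subsetP => e; rewrite !inE.
by case/andP=> /andP[-> _] ->.
Qed.

(** The assumptions make [P] the partition into classes connected by [F], vertices missed by [F]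
    being singletons. *)
Variables (F : {set E}) (P : {set {set V}}).
Hypotheses (FE : F \subset edges H) (hP : partition P (verts H)).
Hypothesis FP : forall f, f \in F -> exists2 X, X \in P & ends H f \subset X.
Hypothesis conP : forall X, X \in P -> hconnected (vert_sub (edge_sub H F) X).

Let F_edges f : f \in F -> f \in edges H.
Proof. exact: (fintype.subsetP FE). Qed.

Let F_part f X v : f \in F -> v \in ends H f -> X \in P -> v \in X ->
  ends H f \subset X.
Proof.
move=> /FP[Y PY fY] vf PX vX.
by rewrite (partition_eq hP PX PY vX (fintype.subsetP fY _ vf)).
Qed.

(** Merging along a hyperedge of [F] stays finer than [P], only coarsens, and puts that hyperedge
    inside one part for good. [P0] is arbitrary for the sake of the induction. *)
Lemma foldl_merge_parts (s : seq E) P0 : {subset s <= F} ->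
  partition P0 (verts H) ->
  (forall B, B \in P0 -> exists2 X, X \in P & B \subset X) ->
  let P1 := foldl (fun P f => merge_parts P (ends H f)) P0 s in
  [/\ partition P1 (verts H),
      forall B, B \in P1 -> exists2 X, X \in P & B \subset X,
      forall B, B \in P0 -> exists2 C, C \in P1 & B \subset C &
      forall f, f \in s -> exists2 C, C \in P1 & ends H f \subset C].
Proof.
elim: s P0 => [|f s IH] P0 sF hP0 ref /=.
  by split=> // B PB; exists B.
have fF : f \in F by apply: sF; rewrite inE eqxx.
have fE := F_edges fF.
have c0 := merge_partition hP0 (ends_sub fE) (ends_neq0 fE).
have fC := cover_parts_meeting hP0 (ends_sub fE).
have merged : cover (parts_meeting P0 (ends H f)) \in merge_parts P0 (ends H f).
  by apply/merge_partsP; left.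
have [||| h1 h2 h3 h4] := IH (merge_parts P0 (ends H f)).
- by move=> g gs; apply: sF; rewrite inE gs orbT.
- exact: c0.
- move=> B /merge_partsP[->|[/ref]//].
  have [X PX fX] := FP fF; exists X => //; apply/bigcupsP => C /parts_meetingP[PC [v vC vf]].
  have [Y PY CY] := ref _ PC.
  by rewrite (partition_eq hP PX PY (fintype.subsetP fX _ vf) (fintype.subsetP CY _ vC)).
split=> // [B PB|g].
  suff [C PC BC] : exists2 C, C \in merge_parts P0 (ends H f) & B \subset C.
    by have [C' PC' CC'] := h3 _ PC; exists C' => //; apply: fintype.subset_trans CC'.
  case: (boolP (B \in parts_meeting P0 (ends H f))) => hB.
    by exists (cover (parts_meeting P0 (ends H f))) => //; exact: bigcup_sup.
  by exists B => //; apply/merge_partsP; right.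
rewrite inE => /predU1P[->|/h4//].
by have [C PC CC] := h3 _ merged; exists C => //; apply: fintype.subset_trans CC.
Qed.

(** The result is finer than [P]. A part strictly inside some [X] of [P] would be left by a
    hyperedge of [F], as [X] is connected, but every contracted hyperedge lies in one part. *)
Lemma contracted_parts :
  foldl (fun P f => merge_parts P (ends H f)) [set [set v] | v in verts H] (enum F) = P.
Proof.
have [|||h1 h2 _ h4] := @foldl_merge_parts (enum F) [set [set v] | v in verts H].
- by move=> f; rewrite mem_enum.
- exact: partition_singletons.
- move=> B /imsetP[v vV ->]; have [X PX vX] := partition_memP hP vV.
  by exists X; rewrite // sub1set.
set P1 := foldl _ _ _ in h1 h2 h4 *.
have same C X x : C \in P1 -> X \in P -> x \in C -> x \in X -> C = X.
  move=> PC PX xC xX; have [Y PY CY] := h2 _ PC.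
  have CX : C \subset X.
    by rewrite (partition_eq hP PX PY xX (fintype.subsetP CY _ xC)).
  apply/eqP; rewrite eqEproper CX /=; apply/negP => CpX.
  have [e [v [w [eL ve vC we]]]] := hconnectedP (conP PX) (partition_neq0 h1 PC) CpX.
  rewrite inE => /andP[wC _].
  move: eL; rewrite edges_part_sub // inE => /andP[eF _].
  have [C' PC' eC'] := h4 e (etrans (mem_enum _ _) eF).
  move: wC; rewrite (partition_eq h1 PC PC' vC (fintype.subsetP eC' _ ve)).
  by rewrite (fintype.subsetP eC').
apply/setP => X; apply/idP/idP => PX.
  have [x xX] := set0Pn _ (partition_neq0 h1 PX).
  have [Y PY xY] := partition_memP hP (fintype.subsetP (partitionS h1 PX) _ xX).
  by rewrite (same _ _ _ PX PY xX xY).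
have [x xX] := set0Pn _ (partition_neq0 hP PX).
have [Y PY xY] := partition_memP h1 (fintype.subsetP (partitionS hP PX) _ xX).
by rewrite -(same _ _ _ PY PX xY xX).
Qed.

Lemma hconnected_sub_part Y X v : hconnected (vert_sub (edge_sub H F) Y) ->
  X \in P -> v \in X -> v \in Y -> Y \subset X.
Proof.
move=> conY PX vX vY; apply: contraT => /subsetPn[w wY wX].
have [||e [a [b [eL ae /setIP[aY aX] be]]]] := hconnectedP (X := Y :&: X) conY.
- by apply/set0Pn; exists v; rewrite inE vY.
- by apply/properP; split; [exact: finset.subsetIl|exists w; rewrite // inE (negbTE wX) andbF].
rewrite inE => /andP[bYX bY]; move: eL bYX; rewrite edges_part_sub // inE => /andP[eF eY].
by rewrite inE bY (fintype.subsetP (F_part eF ae PX aX)).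
Qed.

(** Singleton parts drop out because their vertex lies in no hyperedge of [F], while connectivity
    puts every vertex of a larger part in one. *)
Lemma component_setsE :
  component_sets (edge_sub H F) = [set X in P | (2 <= #|X|)%N].
Proof.
have vE v : v \in verts (edge_sub H F) -> exists f, f \in F /\ v \in ends H f.
  by move=> /bigcupP[f /setIP[_ fF] vf]; exists f.
have isc X : X \in P -> (2 <= #|X|)%N ->
    [&& X \subset verts (edge_sub H F), X != set0 & hconnected (vert_sub (edge_sub H F) X)].
  move=> PX cX; rewrite (partition_neq0 hP PX) conP // !andbT.
  apply/fintype.subsetP => v vX.
  have [||e [a [b [eL ae aX _ _]]]] := hconnectedP (X := [set v]) (conP PX).
  - by rewrite -card_gt0 cards1.
  - by rewrite properEcard sub1set cards1 vX.
  move: eL; rewrite edges_part_sub // inE => /andP[eF _].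
  apply/bigcupP; exists e; first by rewrite inE F_edges.
  by move/set1P: aX => <-.
apply/setP => Y; rewrite !inE; apply/idP/andP => [mY|[PY cY]]; last first.
  apply/maxsetP; split; first exact: isc.
  move=> Z /and3P[_ _ conZ] YZ; have [x xY] := set0Pn _ (partition_neq0 hP PY).
  apply/eqP; rewrite finset.eqEsubset YZ andbT.
  exact: hconnected_sub_part conZ PY xY (fintype.subsetP YZ _ xY).
have /and3P[YV Y0 conY] := maxsetp mY.
have [y yY] := set0Pn _ Y0.
have [f [fF yf]] := vE _ (fintype.subsetP YV _ yY).
have [X PX fX] := FP fF; have yX := fintype.subsetP fX _ yf.
have cX : (2 <= #|X|)%N by apply: leq_trans (subset_leq_card fX); rewrite ends_card ?F_edges.
by rewrite -(maxsetsup mY (isc _ PX cX) (hconnected_sub_part conY PX yX yY)).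
Qed.

End Components.

(** * Quotients inherit partition-connectivity *)

Section Quotient.
Variables (V E : finType) (H : hypergraph V E) (P : {set {set V}}).
Hypothesis hP : partition P (verts H).

(** By contraposition: a loop of the quotient stays inside a coarser part, and a hyperedge meeting
    parts of one class only lies in the cover of that class. *)
Lemma crossing_cover (PP : {set {set {set V}}}) : partition PP P ->
  crossing H (cover @: PP) \subset crossing (quotient_hypergraph H P) PP.
Proof.
move=> hPP; have [hC _] := partition_partition hP hPP.
apply/fintype.subsetP => e; apply: contraTT.
case: (boolP (e \in crossing H P)) => [eP|eP _]; last first.
  apply: contra eP; apply/fintype.subsetP; apply: crossing_anti => // X PX.
  have [B PB XB] := partition_memP hPP PX.
  by exists (cover B); [exact: imset_f|exact: bigcup_sup].
have eE := fintype.subsetP (crossing_sub H P) _ eP.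
rewrite notin_crossing // => /exists_inP[B PB eB].
rewrite notin_crossing //; apply/exists_inP; exists (cover B); first exact: imset_f.
apply: fintype.subset_trans (cover_parts_meeting hP (ends_sub eE)) _.
by apply/bigcupsP => X XB; apply: bigcup_sup; exact: (fintype.subsetP eB).
Qed.

Lemma quotient_partition_connected :
  partition_connected H -> partition_connected (quotient_hypergraph H P).
Proof.
move=> pc PP hPP; have [hC inj] := partition_partition hP hPP.
have := pc _ hC; rewrite card_in_imset // => /leq_trans; apply.
exact: subset_leq_card (crossing_cover hPP).
Qed.

End Quotient.

(** * Strong vectors under quotient, restriction and gluing *)

Section StrongVectors.
Variables (R : realType) (V E : finType) (H : hypergraph V E).
Implicit Types (P : {set {set V}}) (x : E -> R) (A B F : {set E}).

Lemma ler_sum_setS A B (w : E -> R) : A \subset B ->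
  (forall e, e \in B -> 0 <= w e) -> \sum_(e in A) w e <= \sum_(e in B) w e.
Proof.
move=> AB w0; rewrite [leRHS](big_setID A) /= (finset.setIidPr AB) lerDl.
by apply: sumr_ge0 => e /setDP[eB _]; exact: w0.
Qed.

Lemma min1_ge0 (a : R) : 0 <= a -> 0 <= Num.min a 1.
Proof. by move=> a0; rewrite le_min a0 ler01. Qed.

Lemma strong_eq (x y : E -> R) : (forall e, e \in edges H -> x e = y e) ->
  strong H x -> strong H y.
Proof.
move=> xy sx P hP; rewrite (eq_bigr (fun e => Num.min (x e) 1)) ?sx // => e.
by move/(fintype.subsetP (crossing_sub _ _))/xy ->.
Qed.

Lemma strong_quotient P x : partition P (verts H) ->
  (forall e, 0 <= x e) -> strong H x -> strong (quotient_hypergraph H P) x.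
Proof.
move=> hP x0 sx PP hPP; have [hC inj] := partition_partition hP hPP.
have := sx _ hC; rewrite card_in_imset // => le; apply: le_trans le _.
by rewrite lerD2r ler_sum_setS ?crossing_cover // => e _; exact: min1_ge0.
Qed.

(** Replace [X] by [P'] in [P]. This adds [#|P'| - 1] parts, and a crossing hyperedge crosses [P]
    or, inside [X], crosses [P']. As [P] attains equality, the inequality left over is that of
    [P']. *)
Lemma strong_part F P X x : F = edges H :\: crossing H P ->
  partition P (verts H) -> X \in P -> (forall e, 0 <= x e) -> strong H x ->
  \sum_(e in crossing H P) Num.min (x e) 1 + 1 = #|P|%:R ->
  strong (vert_sub (edge_sub H F) X) x.
Proof.
move=> FE hP PX x0 sx sumP P' hP'; set L := vert_sub _ _.
have XV := partitionS hP PX.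
have disjP' (B : {set V}) : B \in P' -> B \in P -> B = X.
  move=> PB' PB; have [v vB] := set0Pn _ (partition_neq0 hP PB).
  exact: partition_eq hP PB PX vB (fintype.subsetP (partitionS hP' PB') _ vB).
have meetX (A : {set V}) v : A \in P' -> v \in A -> v \in X.
  by move=> PA; exact: (fintype.subsetP (partitionS hP' PA)).
have hU : partition (P' :|: P :\ X) (verts H).
  apply: partition_intro => [B|v vV|A B v].
  - move=> /setUP[PB|/setD1P[_ PB]].
      by rewrite (partition_neq0 hP' PB) (fintype.subset_trans (partitionS hP' PB)).
    by rewrite (partition_neq0 hP PB) (partitionS hP PB).
  - have [B PB vB] := partition_memP hP vV.
    have [BX|BX] := eqVneq B X; last by exists B => //; rewrite !inE BX PB orbT.
    have [C PC vC] : exists2 C, C \in P' & v \in C by apply: (partition_memP hP'); rewrite -BX.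
    by exists C => //; rewrite inE PC.
  - move=> /setUP[PA|/setD1P[AX PA]] /setUP[PB|/setD1P[BX PB]] vA vB.
    + exact: partition_eq hP' PA PB vA vB.
    + by move: BX; rewrite (partition_eq hP PB PX vB (meetX _ _ PA vA)) eqxx.
    + by move: AX; rewrite (partition_eq hP PA PX vA (meetX _ _ PB vB)) eqxx.
    + exact: partition_eq hP PA PB vA vB.
have cU : (#|P' :|: P :\ X| + 1 = #|P'| + #|P|)%N.
  rewrite cardsU (_ : P' :&: (P :\ X) = set0) ?cards0 ?subn0.
    by rewrite (cardsD1 X P) PX add1n addn1 addnS.
  apply/setP => B; rewrite !inE; apply/negP => /and3P[PB' BX PB].
  by rewrite (disjP' _ PB' PB) eqxx in BX.
have crU : crossing H (P' :|: P :\ X) \subset crossing H P :|: crossing L P'.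
  apply/fintype.subsetP => e; apply: contraTT; rewrite inE negb_or => /andP[eP eP'].
  case: (boolP (e \in edges H)) => eE; last first.
    by apply: contra eE; exact: (fintype.subsetP (crossing_sub _ _)).
  rewrite notin_crossing //; apply/exists_inP.
  have eF : e \in F by rewrite FE inE eP.
  have := eP; rewrite notin_crossing // => /exists_inP[Y PY eY].
  have [YX|YX] := eqVneq Y X; last by exists Y => //; rewrite !inE YX PY orbT.
  have eL : e \in edges L by rewrite !inE eE eF -YX eY.
  move: eP'; rewrite (notin_crossing hP' eL) => /exists_inP[B PB eB].
  by exists B => //; rewrite inE PB.
have := sx _ hU; have : (#|P' :|: P :\ X| + 1)%:R = (#|P'| + #|P|)%:R :> R by rewrite cU.
have le := ler_sum_setS crU (fun e _ => min1_ge0 (x0 e)).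
have le2 : \sum_(e in crossing H P :|: crossing L P') Num.min (x e) 1 <=
    \sum_(e in crossing H P) Num.min (x e) 1 + \sum_(e in crossing L P') Num.min (x e) 1.
  rewrite (big_setID (crossing H P)) /= finset.setUK lerD2l.
  apply: ler_sum_setS => [|e _]; last exact: min1_ge0.
  by apply/fintype.subsetP => e; rewrite !inE => /andP[/negbTE ->].
rewrite !natrD; lra.
Qed.

(* Replacing a strong vector inside a part X keeps it strong: a partition of V
   is split into its trace on X and the partition merging the parts meeting X. *)
Lemma strong_glue F X (x : E -> R) (y z : E -> R) : F \subset edges H ->
  X != set0 -> X \subset verts H -> (forall e, 0 <= x e) -> (forall e, 0 <= y e) ->
  strong H x -> strong (vert_sub (edge_sub H F) X) y ->
  (forall e, z e = if e \in inside H F X then y e else x e) -> strong H z.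
Proof.
move=> FE X0 XV x0 y0 sx sy zE P hP.
have hM := merge_partition hP XV X0; have cM := card_merge_parts hP XV X0.
have [hT cT] := restrict_partition hP XV.
have := sx _ hM; have := sy _ hT; rewrite cT.
set cL := crossing _ _; set cMP := crossing _ _.
have inL e : e \in cL -> e \in inside H F X.
  by rewrite -(edges_part_sub X FE); apply: (fintype.subsetP (crossing_sub _ _)).
have LP : cL \subset crossing H P.
  apply/fintype.subsetP => e eL; move: (eL); apply: contraTT => eP.
  have := inL _ eL; rewrite inE => /andP[eF eX].
  have eE := fintype.subsetP FE _ eF.
  move: eP; rewrite notin_crossing // => /exists_inP[B PB eB].
  rewrite notin_crossing //; last by rewrite edges_part_sub // inE eF.
  have [v ve] := set0Pn _ (ends_neq0 eE).
  apply/exists_inP; exists (B :&: X); last by rewrite finset.subsetI eB eX.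
  apply: imset_f; apply/parts_meetingP; split=> //; exists v.
    exact: (fintype.subsetP eB).
  exact: (fintype.subsetP eX).
have cX := cover_parts_meeting hP XV.
have mergeX : cover (parts_meeting P X) \in merge_parts P X by apply/merge_partsP; left.
have MP : cMP \subset crossing H P.
  apply: crossing_anti => // B PB; case: (boolP (B \in parts_meeting P X)) => hB.
    by exists (cover (parts_meeting P X)) => //; exact: bigcup_sup.
  by exists B => //; apply/merge_partsP; right.
have outM e : e \in cMP -> e \notin inside H F X.
  move=> eM; apply/negP; rewrite inE => /andP[eF eX].
  have eE := fintype.subsetP FE _ eF.
  move: eM; apply/negP; rewrite notin_crossing //; apply/exists_inP.
  by exists (cover (parts_meeting P X)) => //; apply: fintype.subset_trans cX.
have z0 e : 0 <= Num.min (z e) 1 by rewrite zE; case: ifP => _; exact: min1_ge0.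
(* These are disjoint sets on which [z] equals [y] and [x] respectively, so the two strong
   inequalities add up. *)
have U : cL :|: cMP \subset crossing H P by rewrite finset.subUset LP.
have := ler_sum_setS U (fun e _ => z0 e).
rewrite (big_setID cL) /= finset.setUK.
rewrite (_ : (cL :|: cMP) :\: cL = cMP); last first.
  apply/setP => e; rewrite in_setD finset.in_setU.
  case: (boolP (e \in cL)) => //= eL; apply/esym/negP => /outM.
  by rewrite (inL _ eL).
rewrite (eq_bigr (fun e => Num.min (y e) 1)) => [|e /inL eL]; last by rewrite zE eL.
rewrite [X in _ + X](eq_bigr (fun e => Num.min (x e) 1)) => [|e /outM /negbTE eM]; last by rewrite zE eM.
have : (#|merge_parts P X| + #|parts_meeting P X|)%:R = #|P|.+1%:R :> R by rewrite cM.
rewrite natrD -natr1; lra.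
Qed.

End StrongVectors.

(** * The top level set of the optimal density *)

Section Structure.
Variables (R : realType) (V E : finType) (H : hypergraph V E).
Variable eta : {ffun E -> R}.
Hypothesis V2 : (2 <= #|verts H|)%N.
Hypothesis pcH : partition_connected H.
Hypothesis min_eta : minimizer (edges H) (blocker_hypertrees R H) eta.

Let V0 : (0 < #|verts H|)%N. Proof. exact: ltnW. Qed.

Lemma minimizer_ge0 e : 0 <= eta e.
Proof. by have [[[]]] := min_eta. Qed.

Lemma minimizer_strong : strong H eta.
Proof. by have [/(Adm_blocker _ V0 pcH)[]] := min_eta. Qed.

(** Truncation at 1 keeps the density admissible and cannot increase the energy, so minimality
    forces equality in each coordinate. *)
Lemma minimizer_le1 e : e \in edges H -> eta e <= 1.
Proof.
have [/(Adm_blocker _ V0 pcH)[[eta0 etaD] seta] mine] := min_eta.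
pose x : {ffun E -> R} := [ffun e => Num.min (eta e) 1].
have : Adm (edges H) (blocker_hypertrees R H) x.
  apply/(Adm_blocker _ V0 pcH); split.
    split=> f; rewrite ffunE; first exact: min1_ge0.
    by move=> /etaD ->; rewrite min_l // ler01.
  move=> P hP; rewrite (eq_bigr (fun e => Num.min (eta e) 1)); first exact: seta.
  by move=> f _; rewrite ffunE -minA minxx.
move/mine; rewrite -subr_le0 /energy -sumrB => le0.
have ge0 f : 0 <= eta f ^+ 2 - x f ^+ 2.
  rewrite subr_ge0 ffunE ler_pXn2r ?nnegrE ?min1_ge0 ?eta0 //.
  by rewrite ge_min lexx.
have /eqP := le_anti (introT andP (conj le0 (sumr_ge0 _ (fun f _ => ge0 f)))).
rewrite psumr_eq0 => [/allP h eE|f _]; last exact: ge0.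
have := h e (mem_index_enum e); rewrite eE /= subr_eq0 eqrXn2 ?minimizer_ge0 //.
  by move=> /eqP ->; rewrite ffunE ge_min lexx orbT.
by rewrite ffunE min1_ge0 // eta0.
Qed.

Let Emax := argmax_edges (edges H) eta.
Let F := edges H :\: Emax.

Hypothesis nonconstant : ~ (exists c : R, forall e, e \in edges H -> eta e = c).

(** [m] is the maximum of [eta] and [t] the next lower value, which exists because [eta] is not
    constant. *)
Lemma max_level : exists m t, [/\ 0 <= t < m, m <= 1, F = sublevel H eta t &
  forall e, e \in Emax -> eta e = m].
Proof.
have EmaxP e : reflect (e \in edges H /\ forall f, f \in edges H -> eta f <= eta e) (e \in Emax).
  by rewrite inE; apply: (iffP andP) => -[eE] => [/forall_inP|] h; split=> //; exact/forall_inP.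
have [e0 e0E] : exists e0, e0 \in edges H.
  have [h|[e0 e0E]] := set_0Vmem (edges H); last by exists e0.
  by case: nonconstant; exists 0 => e; rewrite h inE.
have [e1 e1M] : exists e1, e1 \in Emax.
  exists [arg max_(e > e0 in edges H) eta e]%O.
  by case: arg_maxP => // e eE emax; apply/EmaxP.
have [e1E e1max] := EmaxP _ e1M.
have maxE e : e \in Emax -> eta e = eta e1.
  by move=> /EmaxP[eE h]; apply: le_anti; rewrite h // e1max.
have [f1 f1F] : exists f1, f1 \in F.
  have [h|[f1 f1F]] := set_0Vmem F; last by exists f1.
  case: nonconstant; exists (eta e1) => e eE; apply: maxE.
  by apply: contraT => eM; have : e \in F by [rewrite inE eM]; rewrite h inE.
pose f0 := [arg max_(e > f1 in F) eta e]%O.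
have [f0F f0max] : f0 \in F /\ forall e, e \in F -> eta e <= eta f0.
  by rewrite /f0; case: arg_maxP.
have lt : eta f0 < eta e1.
  rewrite lt_neqAle e1max ?andbT; last by case/setDP: f0F.
  apply: contraTneq f0F => h; rewrite inE negb_and negbK.
  case: (boolP (f0 \in edges H)) => f0E; last by rewrite orbT.
  by apply/orP; left; apply/EmaxP; split=> // f fE; rewrite h e1max.
exists (eta e1), (eta f0); split=> //.
- by rewrite minimizer_ge0.
- exact: minimizer_le1.
- apply/setP => e; rewrite !inE.
  case: (boolP (e \in edges H)) => eE; rewrite ?andbF //= andbT.
  apply/idP/idP => h.
    by apply: f0max; rewrite inE eE andbT inE eE.
  apply: contraL h => /forall_inP h; rewrite -ltNge; apply: lt_le_trans lt _.
  exact: h.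
Qed.

Lemma max_level_partition : exists P (T : {set E}), [/\ partition P (verts H),
  crossing H P = Emax, \sum_(e in Emax) eta e + 1 = #|P|%:R,
  T \subset F /\ hyperforest H T & forall X, X \in P -> tight H T X].
Proof.
have [m [t [/andP[t0 tm] m1 FE maxE]]] := max_level.
have [T0 mT] := exists_min_hypertree eta V0 pcH.
have [hT _] := mT; have /andP[fT _] := hT.
have eta0 := minimizer_ge0; have eta1 := minimizer_le1.
have MsubE : Emax \subset edges H.
  by apply/fintype.subsetP => e; rewrite inE => /andP[].
have minE e : e \in edges H -> Num.min (eta e) 1 = eta e by move=> /eta1/min_l.
have [le eqthr] := strong_min_hypertree V0 mT (fun e _ => eta0 e) (fun e _ => eta0 e)
  minimizer_strong.
(* Since [eta] is at most 1, the first-order condition at the indicator of [T0] is the reverse of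
   the inequality [le]; equality at level [t] then computes the sum over [Emax]. *)
have ge := minimizer_first_order min_eta (Adm_hypertree R hT).
have sumM : \sum_(e in Emax) eta e = #|T0 :\: F|%:R.
  rewrite FE -eqthr //; last first.
    apply: le_anti; rewrite le /=.
    rewrite (eq_bigr (fun e => eta e ^+ 2)) => [|e eE]; last by rewrite minE.
    apply: le_trans ge _; rewrite -(sum_hypertree eta hT).
    by apply: ler_sum => e _; rewrite ffunE.
  rewrite [RHS](eq_bigr eta) => [|e /andP[eE _]]; last exact: minE.
  apply: eq_bigl => e; case: (boolP (e \in edges H)) => eE /=; last first.
    by apply/negP => /(fintype.subsetP MsubE); rewrite (negbTE eE).
  have /setP/(_ e) := FE; rewrite /F finset.in_setD eE andbT [RHS]inE eE /= => h.
  by rewrite ltNge -h negbK.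
have [P [hP tP cP]] := min_hypertree_rank t V0 mT.
rewrite -FE in tP cP.
have := minimizer_strong hP; rewrite (eq_bigr eta) => [sP|e]; last first.
  by move/(fintype.subsetP (crossing_sub _ _))/minE.
rewrite -cP !natrD lerD2r -sumM [leRHS](big_setID F) /= in sP.
have sub : crossing H P :\: F \subset Emax.
  apply/fintype.subsetP => e /setDP[eP]; rewrite inE negb_and negbK.
  by rewrite (fintype.subsetP (crossing_sub _ _) _ eP) orbF.
have le1 := ler_sum_setS sub (fun e _ => eta0 e).
(* The strong inequality at [P] leaves the number of these hyperedges at most their [eta]-sum, but
   [eta] is below 1 on [F]. *)
have FP0 : F :&: crossing H P = set0.
  apply/eqP; apply: contraT => /set0Pn[e0 e0FP].
  suff : \sum_(e in crossing H P :&: F) eta e < #|F :&: crossing H P|%:R by lra.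
  rewrite finset.setIC -sum1_card natr_sum; apply: ltr_sum.
    by apply/hasP; exists e0; rewrite ?mem_index_enum.
  move=> e /setIP[]; rewrite FE inE => /andP[_ et] _.
  by apply: le_lt_trans et _; apply: lt_le_trans tm m1.
rewrite [crossing H P :&: F]finset.setIC FP0 big_set0 cards0 in sP.
have crE : crossing H P = Emax.
  have crD : crossing H P :\: F = crossing H P.
    by apply/setDidPl; rewrite disjoint_sym -setI_eq0 FP0.
  rewrite crD in sP sub; apply/eqP; rewrite finset.eqEsubset sub /=.
  (* A hyperedge of [Emax] that does not cross would add [m > 0] to a sum already at least that of
     [Emax]. *)
  apply/fintype.subsetP => e eM; apply: contraT => eP.
  have : \sum_(f in e |: crossing H P) eta f <= \sum_(e in Emax) eta e.
    by apply: ler_sum_setS => [|f _]; rewrite ?finset.subUset ?sub1set ?eM.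
  by rewrite big_setU1 //= maxE //; lra.
exists P, (T0 :&: F); split=> //.
  by rewrite -cP FP0 cards0 addn0 natrD sumM.
split; first exact: finset.subsetIr.
by apply: hyperforestS fT; exact: finset.subsetIl.
Qed.

End Structure.

(** * Restriction of densities *)

Section Restriction.
Variables (R : realType) (E : finType) (eta : {ffun E -> R}).

Lemma energy_restrict (D : {set E}) : energy D (restrict_vec D eta) = energy D eta.
Proof. by apply: eq_bigr => e eD; rewrite ffunE eD. Qed.

Lemma orthant_restrict (D : {set E}) : (forall e, 0 <= eta e) ->
  orthant D (restrict_vec D eta).
Proof.
move=> eta0; split=> e; first by rewrite ffunE; case: ifP.
by rewrite ffunE => /negbTE ->.
Qed.

End Restriction.

(** * The restricted optimum minimizes on the parts and on the quotient *)

Section RestrictedMinimizers.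
Variables (R : realType) (V E : finType) (H : hypergraph V E).
Variables (eta : {ffun E -> R}).
Hypothesis V0 : (0 < #|verts H|)%N.
Hypothesis pcH : partition_connected H.

Lemma part_minimizer (F : {set E}) (X : {set V}) : F \subset edges H ->
  X != set0 -> X \subset verts H ->
  partition_connected (vert_sub (edge_sub H F) X) ->
  minimizer (edges H) (blocker_hypertrees R H) eta ->
  strong (vert_sub (edge_sub H F) X) eta ->
  let L := vert_sub (edge_sub H F) X in
  minimizer (edges L) (blocker_hypertrees R L) (restrict_vec (edges L) eta).
Proof.
move=> FE X0 XV pcL meta sL L.
have LE : edges L = inside H F X := edges_part_sub X FE.
have VL : (0 < #|verts L|)%N by rewrite /= card_gt0.
have [Aeta mine] := meta; have [[eta0 etaD] seta] := (Adm_blocker eta V0 pcH).1 Aeta.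
split.
  apply/(Adm_blocker _ VL pcL); split; first exact: orthant_restrict.
  by apply: strong_eq sL => e eL; rewrite ffunE eL.
move=> s /(Adm_blocker _ VL pcL)[[s0 sD] ss]; rewrite energy_restrict.
(* A competitor [s] on the part is spliced into [eta]; the energies outside the part cancel. *)
pose z : {ffun E -> R} := [ffun e => if e \in inside H F X then s e else eta e].
have Az : Adm (edges H) (blocker_hypertrees R H) z.
  apply/(Adm_blocker _ V0 pcH); split; last first.
    by apply: (strong_glue FE X0 XV eta0 s0 seta ss) => e; rewrite ffunE.
  split=> e; rewrite ffunE; first by case: ifP.
  move=> eE; case: ifP => [|_]; last exact: etaD.
  by rewrite inE => /andP[/(fintype.subsetP FE)]; rewrite (negbTE eE).
have LH : edges L \subset edges H.
  apply/fintype.subsetP => e; rewrite LE inE => /andP[eF _].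
  exact: (fintype.subsetP FE).
have := mine _ Az; rewrite /energy
  [leLHS](big_setID (edges L)) [leRHS](big_setID (edges L)) /= (finset.setIidPr LH).
rewrite [X in _ <= X + _](eq_bigr (fun e => s e ^+ 2)) => [|e eL]; last by rewrite ffunE -LE eL.
rewrite [X in _ <= _ + X](eq_bigr (fun e => eta e ^+ 2)) ?lerD2r // => e.
by move=> /setDP[_ eL]; rewrite ffunE -LE (negbTE eL).
Qed.

Lemma quotient_minimizer (P : {set {set V}}) (m : R) :
  partition P (verts H) -> (forall e, 0 <= eta e) -> strong H eta ->
  (forall e, e \in crossing H P -> eta e = m) ->
  \sum_(e in crossing H P) eta e + 1 = #|P|%:R ->
  let Q := quotient_hypergraph H P in
  minimizer (edges Q) (blocker_hypertrees R Q) (restrict_vec (edges Q) eta).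
Proof.
move=> hP eta0 seta etam sumP Q.
have pcQ : partition_connected Q := quotient_partition_connected hP pcH.
have VQ : (0 < #|verts Q|)%N.
  rewrite card_gt0 /=; apply: contraTneq V0 => P0; rewrite -(cover_partition hP) P0.
  by rewrite /cover big_set0 cards0.
split.
  apply/(Adm_blocker _ VQ pcQ); split; first exact: orthant_restrict.
  by apply: strong_eq (strong_quotient hP eta0 seta) => e eQ; rewrite ffunE eQ.
move=> s /(Adm_blocker _ VQ pcQ)[[s0 sD] ss]; rewrite energy_restrict.
(* The finest partition of the quotient bounds the sum of any competitor below by [#|P| - 1], the
   sum of [eta]. *)
have := ss _ (partition_singletons (verts Q)); rewrite card_singletons /= -sumP lerD2r.
have le1 : \sum_(e in crossing Q [set [set v] | v in P]) Num.min (s e) 1 <=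
    \sum_(e in crossing H P) s e.
  apply: le_trans (ler_sum_setS (crossing_sub Q _) (fun e _ => s0 e)).
  by apply: ler_sum => e _; exact: min_le.
move=> /le_trans /(_ le1) le2.
rewrite -subr_ge0 -sumrB.
have m0 : 0 <= m \/ crossing H P = set0.
  have [->|[e eP]] := set_0Vmem (crossing H P); first by right.
  by left; rewrite -(etam e eP).
case: m0 => [m0|->]; last by rewrite big_set0.
(* As [eta] equals [m] here, summing the tangent inequality s^2 - m^2 >= 2m(s - m) does the work of
   Cauchy-Schwarz. *)
apply: (@le_trans _ _ (\sum_(e in crossing H P) 2 * m * (s e - eta e))).
  by rewrite -mulr_sumr sumrB mulr_ge0 ?subr_ge0 // mulr_ge0.
apply: ler_sum => e eP; rewrite (etam _ eP) -subr_ge0.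
have -> : s e ^+ 2 - m ^+ 2 - 2 * m * (s e - m) = (s e - m) ^+ 2 by ring.
exact: sqr_ge0.
Qed.

End RestrictedMinimizers.

(** * Decomposition of the modulus over the components and the quotient *)

Theorem theorem4p5 (R : realType) (V E : finType) (H : hypergraph V E)
    (eta : {ffun E -> R}) :
  (2 <= #|verts H|)%N ->
  partition_connected H ->
  optimal_density (edges H) (blocker_hypertrees R H) eta ->
  ~ (exists c : R, forall e, e \in edges H -> eta e = c) ->
  let Emax := argmax_edges (edges H) eta in
  let F := edges H :\: Emax in
  let Q := hcontract H F in
  let comps := component_sets (edge_sub H F) in
  let L (X : {set V}) := vert_sub (edge_sub H F) X in
  [/\ partition_connected Q /\
        (forall X, X \in comps -> partition_connected (L X)),
      Mod2 (edges H) (blocker_hypertrees R H) =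
        (\sum_(X in comps) Mod2 (edges (L X)) (blocker_hypertrees R (L X))
         + Mod2 (edges Q) (blocker_hypertrees R Q))%E
    & (forall X, X \in comps ->
         optimal_density (edges (L X)) (blocker_hypertrees R (L X))
           (restrict_vec (edges (L X)) eta)) /\
      optimal_density (edges Q) (blocker_hypertrees R Q) (restrict_vec Emax eta)].
Proof.
move=> V2 pcH [meta _] nonconst Emax F Q comps L.
have V0 : (0 < #|verts H|)%N by exact: ltnW.
have eta0 := minimizer_ge0 meta; have seta := minimizer_strong V2 pcH meta.
have eta1 := minimizer_le1 V2 pcH meta.
have [m [_ [_ _ _ etam]]] := max_level V2 pcH meta nonconst.
have [P [T [hP crE sumP [TF hT] tP]]] := max_level_partition V2 pcH meta nonconst.
have FE : F \subset edges H by exact: finset.subsetDl.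
have FcrE : F = edges H :\: crossing H P by rewrite crE.
have FP f : f \in F -> exists2 X, X \in P & ends H f \subset X.
  rewrite FcrE => /setDP[fE]; rewrite notin_crossing // => /exists_inP[X PX fX].
  by exists X.
have pcL X : X \in P -> partition_connected (L X).
  by move=> /tP tX; apply: hypertree_partition_connected (tight_hypertree FE TF hT tX).
have conP X (PX : X \in P) := partition_connected_hconnected (pcL X PX).
have QE : Q = quotient_hypergraph H P.
  by rewrite /Q /hcontract (contracted_parts FE hP FP conP).
have compsE : comps = [set X in P | (2 <= #|X|)%N] := component_setsE FE hP FP conP.
have compsP X : X \in comps -> X \in P by rewrite compsE inE => /andP[].
have QM : edges Q = Emax by rewrite QE /= crE.
have minQ : minimizer (edges Q) (blocker_hypertrees R Q) (restrict_vec (edges Q) eta).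
  by rewrite QE; apply: (quotient_minimizer V0 pcH hP eta0 seta (m := m)); rewrite ?crE.
have minL X : X \in P ->
    minimizer (edges (L X)) (blocker_hypertrees R (L X)) (restrict_vec (edges (L X)) eta).
  move=> PX; apply: part_minimizer => //; first exact: partition_neq0 hP PX.
  - exact: partitionS hP PX.
  - exact: pcL.
  (* As [eta] is at most 1, truncation changes nothing and [sumP] says that [P] attains its strong
     inequality. *)
  - apply: strong_part FcrE hP PX eta0 seta _; rewrite -sumP -crE; congr (_ + 1).
    by apply: eq_bigr => e /(fintype.subsetP (crossing_sub _ _))/eta1/min_l.
split.
- split; first by rewrite QE; exact: quotient_partition_connected.
  by move=> X /compsP/pcL.
- rewrite (Mod2_minimizer meta) (Mod2_minimizer minQ) energy_restrict QM.
  rewrite (eq_bigr (fun X => (energy (inside H F X) eta)%:E)) => [|X /compsP PX].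
    rewrite sumEFin -EFinD; congr EFin.
    (* Non-crossing hyperedges are sorted by part; a one-vertex part contains none, so only the
       components contribute. *)
    rewrite /energy (big_partition_edges _ _ hP (fintype.subxx _)) /=.
    rewrite (finset.setIidPr (crossing_sub H P)) crE; congr (_ + _).
    rewrite [RHS](eq_bigl (fun X => (X \in P) && (2 <= #|X|)%N)) => [|X]; last by rewrite compsE inE.
    rewrite big_mkcondr; apply: eq_bigr => X PX; case: ifP => cX.
      apply: eq_bigl => e; rewrite !inE.
      case: (boolP (e \in edges H)) => eE; rewrite ?andbF //= andbT.
      case: (boolP (ends H e \subset X)) => eX; rewrite ?andbF //= andbT.
      have : e \notin crossing H P by rewrite notin_crossing //; apply/exists_inP; exists X.
      by rewrite crE inE eE.
    rewrite big_pred0 // => e; apply/negP; rewrite inE => /andP[eE /subset_leq_card].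
    by move=> /(leq_trans (ends_card eE)); rewrite cX.
  by rewrite (Mod2_minimizer (minL X PX)) energy_restrict edges_part_sub.
- split=> [X /compsP PX|]; first exact/minimizer_optimal/minL.
  by rewrite -QM; exact: minimizer_optimal.
Qed.
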